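(* Let $(E_n)_{n\in\mathbb{N}}$ be a betting sequence with wealth process $(W_t)$ and with an aggregate $(C_t,\Psi^{(t)})_{t\in\mathbb{N}}$ (for some $s_{\max}\in(0,\infty]$, drift certificate $(c_n)$ and majorant $(\psi_n)$). Then for every $t\in\mathbb{N}$: (a) (Negative moments of the wealth.) For every $s\in[0,s_{\max})$, $\ \mathbb{E}_{\mathbb{P}_1}[W_t^{-s}]\le\exp(-s\,C_t+\Psi^{(t)}(s))$. (b) (Type-II error, sequential and fixed-horizon.) For every $\alpha\in(0,1)$, $\ \bar\gamma_t(\alpha)\le\gamma_t(\alpha)\le\exp\big(-(\Psi^{(t)})^{\star}(\Delta_t)\big)$. (c) (The optimising tilt.) Suppose $\Psi^{(t)}$ is finite, differentiable and strictly convex on $(0,s_{\max})$ with $\Psi^{(t)}(0)=0$. If $\Delta_t>\lim_{s\downarrow0}(\Psi^{(t)})'(s)$, then the supremum $(\Psi^{(t)})^{\star}(\Delta_t)=\sup_{s\in[0,s_{\max})}\{s\Delta_t-\Psi^{(t)}(s)\}$ in (b) is attained at the unique $s^{\ast}_t\in(0,s_{\max})$ solving $(\Psi^{(t)})'(s^{\ast}_t)=\Delta_t$, provided such a point exists; otherwise it is approached as $s\uparrow s_{\max}$. If $\Delta_t\le\lim_{s\downarrow0}(\Psi^{(t)})'(s)$, the supremum is $0$, attained at $s^{\ast}_t=0$, and the bound in (b) is trivial. (d) (Time-uniform form.) Fix $s\in(0,s_{\max})$ and $\delta\in(0,1)$. With $\mathbb{P}_1$-probability at least $1-\delta$, simultaneously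 for all $t\in\mathbb{N}_0$, $$\log W_t>C_t-\frac{\Psi^{(t)}(s)+\log\frac1\delta}{s}.$$ (e) (Rejection time.) Consequently, for every $s\in(0,s_{\max})$ and $\delta\in(0,1)$ (and $\alpha\in(0,1)$), $\ \mathbb{P}_1(\tau_\alpha\le T_{s,\delta})\ge1-\delta$, where $$T_{s,\delta}:=\inf\{t\in\mathbb{N}:\ s\,C_t-\Psi^{(t)}(s)\ge s\ell+\log\tfrac1\delta\}.$$
   Context: Conventions: $\log$ is the natural logarithm, $\log0=-\infty$, $e^{-\infty}=0$, $0\cdot\infty=0$; for $x\in[0,\infty]$, $x^0=1$, and for $s>0$, $0^{-s}=+\infty$, $(+\infty)^{-s}=0$; $(x)_+=\max\{x,0\}$; $\mathbb{N}=\{1,2,\dots\}$, $\mathbb{N}_0=\{0,1,\dots\}$. Setting: $(\Omega,\mathcal{F})$ is a measurable space with a filtration $(\mathcal{F}_t)_{t\in\mathbb{N}_0}$, $\mathcal{F}_0=\{\emptyset,\Omega\}$, and $\mathbb{P}_0,\mathbb{P}_1$ are probability measures with $\mathbb{P}_1|_{\mathcal{F}_t}\ll\mathbb{P}_0|_{\mathcal{F}_t}$ for all $t$. A betting sequence is a family of $\mathcal{F}_n$-measurable maps $E_n:\Omega\to[0,\infty]$ with $\mathbb{E}_{\mathbb{P}_0}[E_n\mid\mathcal{F}_{n-1}]\le1$ $\mathbb{P}_0$-a.s. Wealth: $W_0=1$, $W_t=\prod_{n\le t}E_n$; $L_n:=\log E_n$. For $\alpha\in(0,1)$: $\ell:=\log\frac1\alpha$,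 $\tau_\alpha:=\inf\{t\in\mathbb{N}:W_t>\frac1\alpha\}$, $\gamma_t(\alpha):=\mathbb{P}_1(W_t\le\frac1\alpha)$, $\bar\gamma_t(\alpha):=\mathbb{P}_1(\tau_\alpha>t)$. Drift certificate: real random variables $(c_n)_{n\in\mathbb{N}}$, $c_n$ being $\mathcal{F}_{n-1}$-measurable, with $\mathbb{E}_{\mathbb{P}_1}[L_n\mid\mathcal{F}_{n-1}]\ge c_n$ $\mathbb{P}_1$-a.s. for every $n$. Put $\varphi_n(s):=\log\mathbb{E}_{\mathbb{P}_1}[e^{-s(L_n-c_n)}\mid\mathcal{F}_{n-1}]$, $s\ge0$. Majorant on $[0,s_{\max})$: maps $\psi_n:[0,s_{\max})\times\Omega\to[0,\infty]$ with $\psi_n(s)$ $\mathcal{F}_{n-1}$-measurable for each $s$, $\psi_n(0)=0$, and $\varphi_n(s)\le\psi_n(s)$ $\mathbb{P}_1$-a.s. for every $n$ and $s\in[0,s_{\max})$. Aggregate: deterministic $C_t\in\mathbb{R}$ and $\Psi^{(t)}:[0,s_{\max})\to[0,\infty]$ such that for every $t\in\mathbb{N}$ and $s\in[0,s_{\max})$, $\mathbb{P}_1$-a.s., $\sum_{n\le t}c_n\ge C_t$ and $\sum_{n\le t}\psi_n(s)\le\Psi^{(t)}(s)$; by convention $C_0:=0$, $\Psi^{(0)}:\equiv0$. Deviation: $\Delta_t:=(C_t-\ell)_+$. Rate function: $(\Psi^{(t)})^{\star}(x):=\sup_{s\in[0,s_{\max})}\{sx-\Psi^{(t)}(s)\}$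 for $x\ge0$.
   Formalization: In (c), the case Δ_t > lim (Ψ^{(t)})'(s) additionally assumes Ψ^{(t)}(s) → Ψ^{(t)}(0) = 0 as s↓0 (automatic if Ψ^{(t)} is convex on [0,s_max)); with a jump at 0 the claim can fail, e.g. Ψ^{(t)}(s) = B + s² for s > 0 with B large. *)

(* Defs.v *)
From HB Require Import structures.
From mathcomp Require Import all_boot all_order all_algebra.
From mathcomp Require Import all_classical all_reals all_analysis.
From mathcomp Require Import measurable_realfun.

Set Implicit Arguments.
Unset Strict Implicit.
Unset Printing Implicit Defensive.

Import Order.TTheory GRing.Theory Num.Theory.
Import numFieldNormedType.Exports.

Local Open Scope classical_set_scope.
Local Open Scope ring_scope.
Local Open Scope ereal_scope.

Definition measurable_wrt (T : Type) (G : set (set T)) (d : measure_display)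
    (U : measurableType d) (f : T -> U) : Prop :=
  forall B : set U, measurable B -> G (f @^-1` B).

Record is_filtration (d : measure_display) (T : measurableType d)
    (F : nat -> set (set T)) : Prop := {
  filtration_sigma : forall n, sigma_algebra [set: T] (F n) ;
  filtration_sub : forall n, F n `<=` measurable ;
  filtration_incr : forall n, F n `<=` F n.+1 ;
  filtration0 : F 0%N = [set set0; [set: T]] }.

(* Y is a version of E_P[X | G], for a measurable X with values in [0, +oo]
   (the value +oo is allowed for Y, and no integrability is required).
   Versions are almost surely unique, so an almost sure statement about
   E_P[X | G] is expressed below as a statement about some version. *)
Definition is_condexp (d : measure_display) (T : measurableType d)
    (R : realType) (P : probability T R) (G : set (set T))
    (X Y : T -> \bar R) : Prop :=
  [/\ measurable_wrt G Y, (forall w, 0 <= Y w) &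
      forall A, G A -> \int[P]_(w in A) Y w = \int[P]_(w in A) X w].

(* Y is a version of E_P[X | G] for an X with values in [-oo, +oo], in the
   generalized sense E[X^+ | G] - E[X^- | G], the difference being almost
   surely well defined. *)
Definition is_condexp_gen (d : measure_display) (T : measurableType d)
    (R : realType) (P : probability T R) (G : set (set T))
    (X Y : T -> \bar R) : Prop :=
  exists Yp Yn : T -> \bar R,
    [/\ is_condexp P G (X^\+) Yp, is_condexp P G (X^\-) Yn,
        {ae P, forall w, Yp w < +oo \/ Yn w < +oo},
        measurable_wrt G Y &
        {ae P, forall w, Y w = Yp w - Yn w}].

(* Sequences indexed by {1, 2, ...} are functions on nat whose value at 0 is
   never used. *)
Record betting_sequence (d : measure_display) (T : measurableType d)
    (R : realType) (P0 : probability T R) (F : nat -> set (set T))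
    (E : nat -> T -> \bar R) : Prop := {
  betting_ge0 : forall n w, (0 < n)%N -> 0 <= E n w ;
  betting_measurable : forall n, (0 < n)%N -> measurable_wrt (F n) (E n) ;
  betting_fair : forall n, (0 < n)%N ->
    exists2 Y, is_condexp P0 (F n.-1) (E n) Y &
               {ae P0, forall w, Y w <= 1} }.

Definition wealth (T : Type) (R : realType) (E : nat -> T -> \bar R)
    (t : nat) (w : T) : \bar R :=
  \big[*%E/1]_(1 <= n < t.+1) E n w.

Definition logE (T : Type) (R : realType) (E : nat -> T -> \bar R)
    (n : nat) (w : T) : \bar R := lne (E n w).

(* x^{-s} for x in [0, +oo] and s >= 0, with x^0 = 1 and, for s > 0,
   0^{-s} = +oo and (+oo)^{-s} = 0. The library's poweR follows other
   conventions for negative exponents; the value at -oo is irrelevant. *)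
Definition negpow (R : realType) (x : \bar R) (s : R) : \bar R :=
  if s == 0%R then 1 else
  match x with
  | r%:E => if r == 0%R then +oo else (r `^ (- s))%:E
  | _ => 0
  end.

(* inf {t in {1, 2, ...} | A t}, equal to +oo when there is no such t. *)
Definition first_time (R : realType) (A : nat -> Prop) : \bar R :=
  ereal_inf [set (t%:R)%:E | t in [set t : nat | (0 < t)%N /\ A t]].

Definition rejection_time (T : Type) (R : realType) (E : nat -> T -> \bar R)
    (alpha : R) (w : T) : \bar R :=
  first_time R (fun t => (alpha^-1)%:E < wealth E t w).

Definition type2_fixed (d : measure_display) (T : measurableType d)
    (R : realType) (P1 : probability T R) (E : nat -> T -> \bar R)
    (alpha : R) (t : nat) : \bar R :=
  P1 [set w | wealth E t w <= (alpha^-1)%:E].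

Definition type2_seq (d : measure_display) (T : measurableType d)
    (R : realType) (P1 : probability T R) (E : nat -> T -> \bar R)
    (alpha : R) (t : nat) : \bar R :=
  P1 [set w | (t%:R)%:E < rejection_time E alpha w].

Record drift_certificate (d : measure_display) (T : measurableType d)
    (R : realType) (P1 : probability T R) (F : nat -> set (set T))
    (E : nat -> T -> \bar R) (c : nat -> T -> R) : Prop := {
  drift_measurable : forall n, (0 < n)%N -> measurable_wrt (F n.-1) (c n) ;
  drift_le : forall n, (0 < n)%N ->
    exists2 Y, is_condexp_gen P1 (F n.-1) (logE E n) Y &
               {ae P1, forall w, (c n w)%:E <= Y w} }.

(* phi is a version of phi_n(s) = log E_{P1}[e^{-s(L_n - c_n)} | F_{n-1}]. *)
Definition is_log_condmgf (d : measure_display) (T : measurableType d)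
    (R : realType) (P1 : probability T R) (F : nat -> set (set T))
    (E : nat -> T -> \bar R) (c : nat -> T -> R) (n : nat) (s : R)
    (phi : T -> \bar R) : Prop :=
  exists2 Y,
    is_condexp P1 (F n.-1)
      (fun w => expeR (- (s%:E * (logE E n w - (c n w)%:E)))) Y &
    phi = (fun w => lne (Y w)).

(* The intervals [0, smax) and (0, smax), where smax may be +oo. *)
Definition tilts (R : realType) (smax : \bar R) : set R :=
  [set s | (0 <= s)%R /\ s%:E < smax].
Definition pos_tilts (R : realType) (smax : \bar R) : set R :=
  [set s | (0 < s)%R /\ s%:E < smax].

Record majorant (d : measure_display) (T : measurableType d)
    (R : realType) (P1 : probability T R) (F : nat -> set (set T))
    (E : nat -> T -> \bar R) (c : nat -> T -> R) (smax : \bar R)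
    (psi : nat -> R -> T -> \bar R) : Prop := {
  majorant_ge0 : forall n s w, (0 < n)%N -> tilts smax s -> 0 <= psi n s w ;
  majorant_measurable : forall n s, (0 < n)%N -> tilts smax s ->
    measurable_wrt (F n.-1) (psi n s) ;
  majorant0 : forall n w, (0 < n)%N -> psi n 0%R w = 0 ;
  majorant_le : forall n s, (0 < n)%N -> tilts smax s ->
    exists2 phi, is_log_condmgf P1 F E c n s phi &
                 {ae P1, forall w, phi w <= psi n s w} }.

Record aggregate (d : measure_display) (T : measurableType d)
    (R : realType) (P1 : probability T R) (c : nat -> T -> R)
    (smax : \bar R) (psi : nat -> R -> T -> \bar R)
    (C : nat -> R) (Psi : nat -> R -> \bar R) : Prop := {
  aggregate_ge0 : forall t s, (0 < t)%N -> tilts smax s -> 0 <= Psi t s ;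
  aggregate_le : forall t s, (0 < t)%N -> tilts smax s ->
    {ae P1, forall w, (C t <= \sum_(1 <= n < t.+1) c n w)%R /\
                      \sum_(1 <= n < t.+1) psi n s w <= Psi t s} ;
  aggregate_C0 : C 0%N = 0%R ;
  aggregate_Psi0 : forall s, tilts smax s -> Psi 0%N s = 0 }.

Definition deviation (R : realType) (C : nat -> R) (alpha : R) (t : nat) : R :=
  Num.max (C t - ln (alpha^-1))%R 0%R.

Definition rate (R : realType) (smax : \bar R) (Psi : R -> \bar R) (x : R) :
    \bar R :=
  ereal_sup [set (s * x)%:E - Psi s | s in tilts smax].

Definition rejection_horizon (R : realType) (C : nat -> R)
    (Psi : nat -> R -> \bar R) (alpha s delta : R) : \bar R :=
  first_time R (fun t =>
    (s * ln (alpha^-1) + ln (delta^-1))%:E <= (s * C t)%:E - Psi t s).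

Definition strictly_convex_on (R : realType) (I : set R) (f : R -> R) : Prop :=
  forall x y p : R, I x -> I y -> x != y -> (0 < p < 1)%R ->
    (f (p * x + (1 - p) * y) < p * f x + (1 - p) * f y)%R.

(* The filter of s increasing to smax, for smax in (0, +oo]. *)
Definition upto (R : realType) (smax : \bar R) : set_system R :=
  if smax is r%:E then at_left r else pinfty_nbhs R.

(* Main.v *)
(* For fixed s the process
     M_t = prod_(n <= t) exp (- s (L_n - c_n) - psi_n(s))
   is a nonnegative P1-supermartingale with M_0 = 1, because psi_n(s) dominates
   the conditional log-moment generating function. Its mean bounds the negative
   moments of the wealth, Markov's inequality turns these into the type-II
   bounds, and Ville's maximal inequality gives the time-uniform statement.
   P1-almost surely every E_n lies in (0, +oo): it is not +oo because
   E_P0[E_n] <= 1 and P1 << P0, and not 0 because E_P1[L_n | F_(n-1)] >= c_n.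
   The optimal tilt is found from the tangent inequality of a strictly convex
   function. *)
Require Import Defs.
From HB Require Import structures.
From mathcomp Require Import all_boot all_order all_algebra.
From mathcomp Require Import all_classical all_reals all_analysis.
From mathcomp Require Import measurable_realfun.
From mathcomp Require Import ring lra.
Import Order.TTheory GRing.Theory Num.Theory.
Import numFieldNormedType.Exports.
Import HBNNSimple.
Local Open Scope classical_set_scope.
Local Open Scope ring_scope.
Local Open Scope ereal_scope.

Set Implicit Arguments.
Unset Strict Implicit.
Unset Printing Implicit Defensive.

(** Conditional expectations are versions that may take the value +oo and are tested only on sets,
    and nothing is assumed integrable under [P1]. The argument therefore stays with nonnegative
    integrands, and the supermartingale property is an inequality of integrals over the sets of
    [F n]. The almost sure location of the bets in (0, +oo) is what ties [M_t] to [W_t^{-s}]. If one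
    bet is 0 and another +oo, then 0 * oo = 0 gives [W_t = 0], so for s > 0 the negative power is
    +oo, whereas the product of the factors of [M_t] is 0. For the optimal tilt the delicate point
    is s = 0: it competes in the supremum, but convexity and derivatives are given only on the open
    interval. When the slope at 0 is below [Delta], right-continuity of [Psi] at 0 settles the
    comparison; in the other regime, where s = 0 must win, nonnegativity of [Psi] does. *)

(** * Measurability, and conditional expectations tested on functions *)

Lemma measurable_expeR (R : realType) :
  measurable_fun [set: \bar R] (@expeR R).
Proof.
rewrite (_ : @expeR R = fun x => if x == +oo then +oo else
    if x == -oo then 0 else (expR (fine x))%:E); last by apply/funext => -[].
apply: measurable_fun_ifT => //=; first exact: measurable_fun_eqe.
apply: measurable_fun_ifT => //=; first exact: measurable_fun_eqe.
by apply/measurable_EFinP; apply: measurableT_comp.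
Qed.

Lemma measurable_lne (R : realType) : measurable_fun [set: \bar R] (@lne R).
Proof.
rewrite (_ : @lne R = fun x => if x == +oo then +oo else
    if x <= 0 then -oo else (ln (fine x))%:E); last first.
  by apply/funext => -[r| |] //=; rewrite leNye.
apply: measurable_fun_ifT => //=; first exact: measurable_fun_eqe.
apply: measurable_fun_ifT => //=; first exact: measurable_fun_lee.
by apply/measurable_EFinP; apply: measurableT_comp.
Qed.

Lemma measurable_negpow (R : realType) (s : R) :
  measurable_fun [set: \bar R] (fun x => negpow x s).
Proof.
rewrite (_ : (fun x => negpow x s) = fun x => if s == 0%R then 1 else
    if x == 0 then +oo else
    if x == +oo then 0 else if x == -oo then 0 else (fine x `^ (- s))%:E);
    last by apply/funext => -[].
apply: measurable_fun_ifT => //=.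
apply: measurable_fun_ifT => //=; first exact: measurable_fun_eqe.
apply: measurable_fun_ifT => //=; first exact: measurable_fun_eqe.
apply: measurable_fun_ifT => //=; first exact: measurable_fun_eqe.
apply/measurable_EFinP.
apply: (@measurableT_comp _ _ _ _ _ _ (@powR R ^~ (- s)%R)) => //.

Qed.

Lemma negpow_ge0 (R : realType) (x : \bar R) (s : R) : 0 <= negpow x s.
Proof.
rewrite /negpow; case: ifP => // _; case: x => [r| |] //.
by case: ifP => // _; rewrite lee_fin powR_ge0.
Qed.

(** A member of the filtration is a bare family of sets. Equipping [T] with the sigma-algebra
    generated by [G], which is [G] itself, opens the closure lemmas for measurable functions to
    it. *)
Lemma measurable_wrtP (T : pointedType) (G : set (set T)) (d : measure_display)
    (U : measurableType d) (f : T -> U) : sigma_algebra [set: T] G ->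
  measurable_wrt G f <-> measurable_fun [set: g_sigma_algebraType G] f.
Proof.
move=> sG; split=> [mf _ B mB|mf B mB].
  rewrite setTI; apply: sub_sigma_algebra; exact: mf.
have := mf measurableT B mB.
by rewrite setTI /measurable /= sigma_algebra_id.
Qed.

Lemma measurable_wrtW (d : measure_display) (T : measurableType d)
    (G : set (set T)) (d' : measure_display) (U : measurableType d')
    (f : T -> U) : G `<=` measurable ->
  measurable_wrt G f -> measurable_fun [set: T] f.
Proof. by move=> sG mf _ B mB; rewrite setTI; apply/sG/mf. Qed.

(* Monotone class step behind taking out what is known: the test sets of a
   conditional expectation may be replaced by nonnegative test functions. *)
Lemma integral_test_fun (d : measure_display) (T : measurableType d)
    (R : realType) (mu : measure T R) (G : set (set T)) (X Y U : T -> \bar R) :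
  sigma_algebra [set: T] G -> G `<=` measurable ->
  measurable_fun [set: T] X -> measurable_fun [set: T] Y ->
  (forall w, 0 <= X w) -> (forall w, 0 <= Y w) ->
  (forall A, G A -> \int[mu]_(w in A) Y w = \int[mu]_(w in A) X w) ->
  measurable_wrt G U -> (forall w, 0 <= U w) ->
  \int[mu]_w (U w * Y w) = \int[mu]_w (U w * X w).
Proof.
move=> sG subG mX mY X0 Y0 XY mU U0.
have mUG : measurable_fun [set: g_sigma_algebraType G] U.
  exact/measurable_wrtP.
(* The simple functions are taken on the space equipped with [G], so their level sets lie in [G] and
   are admissible test sets. *)
pose g n : T -> R := nnsfun_approx measurableT mUG n.
have mgG n : measurable_wrt G (g n).
  apply/measurable_wrtP => //; rewrite /g; exact: measurable_funP.
have gG n r : G (g n @^-1` [set r]) by exact: mgG.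
have mg n : measurable_fun [set: T] (fun w => (g n w)%:E).
  by apply/measurable_EFinP; exact: (measurable_wrtW subG).
have g0 n w : (0 <= g n w)%R by exact: fun_ge0.
have g_nd n m w : (n <= m)%N -> (g n w <= g m w)%R.
  by move=> nm; have := nd_nnsfun_approx measurableT mUG nm; move=> /lefP; apply.
have g_cvg w : (g n w)%:E @[n --> \oo] --> U w.
  exact: (cvg_nnsfun_approx measurableT mUG).
have simple (Z : T -> \bar R) n : measurable_fun [set: T] Z ->
    (forall w, 0 <= Z w) ->
    \int[mu]_w ((g n w)%:E * Z w) =
    \sum_(y \in range (g n)) (y%:E * \int[mu]_(w in g n @^-1` [set y]) Z w).
  move=> mZ Z0.
  have term0 y w : 0 <= (y * \1_(g n @^-1` [set y]) w)%:E.
    exact: nnfun_muleindic_ge0.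
  transitivity (\int[mu]_w \sum_(y \in range (g n))
      ((y * \1_(g n @^-1` [set y]) w)%:E * Z w)).
    apply: eq_integral => w _; rewrite -ge0_mule_fsuml//.
    rewrite fsumEFin; last exact: (@fimfunP _ _ (nnsfun_approx measurableT mUG n)).
    by rewrite -(fimfunE (nnsfun_approx measurableT mUG n)).
  have fin_range : finite_set (range (g n)).
    exact: (@fimfunP _ _ (nnsfun_approx measurableT mUG n)).
  rewrite ge0_integral_fsum//; last 2 first.
  - move=> y; apply: emeasurable_funM => //; apply/measurable_EFinP => /=.
    apply: measurable_funM => //; apply: measurable_indic; exact: subG.
  - by move=> y w _; rewrite mule_ge0.
  apply: eq_fsbigr => y /set_mem[v _ <-].
  under eq_integral do rewrite EFinM -muleA.
  rewrite ge0_integralZl ?lee_fin//; last 2 first.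
  - apply: emeasurable_funM => //; apply/measurable_EFinP.
    apply: measurable_indic; exact: subG.
  - by move=> w _; rewrite mule_ge0// lee_fin.
  congr (_ * _); rewrite [RHS]integral_mkcond epatch_indic.
  by apply: eq_integral => w _; rewrite muleC.
have pull (Z : T -> \bar R) : measurable_fun [set: T] Z ->
    (forall w, 0 <= Z w) ->
    \int[mu]_w (U w * Z w) = limn (fun n => \int[mu]_w ((g n w)%:E * Z w)).
  move=> mZ Z0.
  rewrite -monotone_convergence//; last 3 first.
  - by move=> n; exact: emeasurable_funM.
  - by move=> n w _; rewrite mule_ge0// lee_fin.
  - by move=> w _ n m nm; rewrite lee_wpmul2r// lee_fin g_nd.
  apply: eq_integral => w _; apply/esym/cvg_lim => //.
  (* Multiplication is discontinuous at 0 * oo. If [Z w = +oo] and [U w = 0], every [g n w] is 0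
     because it stays below [U w]; if [U w > 0], the limit of the product is well defined. *)
  have [Zfin|] := boolP (Z w \is a fin_num); first exact: cvgeZr.
  rewrite ge0_fin_numE// -leNgt leye_eq => /eqP ->.
  have := U0 w; rewrite le_eqVlt => /predU1P[Uw|Uw].
    rewrite -Uw mul0e.
    rewrite (_ : (fun n => _) = cst 0); first exact: cvg_cst.
    apply/funext => n; suff -> : g n w = 0%R by rewrite mul0e.
    have : (g n w)%:E <= U w by rewrite /g nnsfun_approxE; exact: le_approx.
    by rewrite -Uw lee_fin => gw; apply/eqP; rewrite eq_le g0 gw.
  apply: cvgeM => //; last exact: cvg_cst.
  by rewrite mule_defE gt_eqF.
rewrite !pull//; congr (limn _); apply/funext => n.
rewrite !simple//; apply: eq_fsbigr => y _; congr (_ * _); exact: XY.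
Qed.

(** * Filtrations and Ville's maximal inequality *)

Lemma filtrationI (d : measure_display) (T : measurableType d)
    (F : nat -> set (set T)) (HF : is_filtration F) n A B :
  F n A -> F n B -> F n (A `&` B).
Proof.
rewrite -(sigma_algebra_id (filtration_sigma HF n)) => mA mB.
exact: (@measurableI _ (g_sigma_algebraType (F n))).
Qed.

Lemma filtrationW (d : measure_display) (T : measurableType d)
    (F : nat -> set (set T)) (HF : is_filtration F) n m : (n <= m)%N ->
  F n `<=` F m.
Proof.
move=> /subnK <-; elim: (m - n)%N => //= k IH A /IH.
by rewrite addSn; exact: filtration_incr.
Qed.

(** No stopped process is formed. With [B n] the event that level [a] is not reached before time
    [n], the integral of [M n] over [B n] plus [a] times the probability of the complement of [B n]
    never exceeds the initial mean. Continuity from below covers the infinite horizon. *)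
Lemma ville_inequality (d : measure_display) (T : measurableType d)
    (R : realType) (P : probability T R) (F : nat -> set (set T))
    (M : nat -> T -> \bar R) (a : R) : is_filtration F -> (0 < a)%R ->
  (forall n, measurable_wrt (F n) (M n)) -> (forall n w, 0 <= M n w) ->
  (forall n A, F n A -> \int[P]_(w in A) M n.+1 w <= \int[P]_(w in A) M n w) ->
  a%:E * P [set w | exists t, a%:E <= M t w] <= \int[P]_w M 0%N w.
Proof.
move=> HF a0 mM M0 superM.
pose B n := [set w | forall k, (k < n)%N -> M k w < a%:E].
have sub n := @filtration_sub _ _ _ HF n.
have mM' n : measurable_fun [set: T] (M n).
  by apply: measurable_wrtW (mM n); exact: sub.
have FM n : F n [set w | M n w < a%:E].
  have -> : [set w | M n w < a%:E] = M n @^-1` `]-oo, a%:E[.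
    by apply/seteqP; split => w /=; rewrite in_itv.
  by apply: mM; exact: emeasurable_itv.
have FMC n : measurable [set w | a%:E <= M n w].
  have -> : [set w | a%:E <= M n w] = ~` [set w | M n w < a%:E].
    by apply/seteqP; split => w /=; rewrite leNgt => /negP.
  by apply: measurableC; exact: sub (FM n).
have BS n : B n.+1 = B n `&` [set w | M n w < a%:E].
  apply/seteqP; split => w /= Bw.
    by split; [move=> k kn; apply: Bw; exact: ltnW|exact: Bw].
  move=> k; rewrite ltnS leq_eqVlt => /predU1P[->|]; first exact: Bw.2.
  exact: Bw.1.
have B0 : B 0%N = setT by apply/seteqP; split.
(* The index shift matters: [B n.+1] looks only at times up to [n], hence is a legitimate test set
   for the passage from [M n] to [M n.+1]. *)
have FBS n : F n (B n.+1).
  elim: n => [|n IH].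
    by rewrite BS B0 setTI.
  by rewrite BS; apply: filtrationI => //; exact: filtration_incr.
have mB n : measurable (B n).
  by case: n => [|n]; [rewrite B0|exact: sub (FBS n)].
have step n : a%:E * P (~` B n) + \int[P]_(w in B n) M n w
    <= \int[P]_w M 0%N w.
  elim: n => [|n IH].
    by rewrite B0 setCT measure0 mule0 add0e.
  apply: le_trans IH.
  have mD : measurable (B n `&` [set w | a%:E <= M n w]).
    exact: measurableI.
  have -> : ~` B n.+1 = ~` B n `|` (B n `&` [set w | a%:E <= M n w]).
    rewrite BS setCI; apply/seteqP; split => w /=.
      case=> [|/negP]; first by left.
      by rewrite -leNgt => Mw; have [|] := pselect (B n w); [right|left].
    by case=> [|[_]]; [left|rewrite leNgt => /negP; right].
  rewrite measureU//; [|exact: measurableC|by rewrite setIA setICl set0I].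
  (* On the newly reached part [M n] is at least [a] and pays for the growth of the probability
     term; on [B n.+1] the supermartingale inequality applies. *)
  have eqB : B n = B n.+1 `|` (B n `&` [set w | a%:E <= M n w]).
    rewrite BS -setIUr; apply/esym/setIidPl => w _ /=.
    by case: (ltP (M n w) a%:E); [left|right].
  rewrite ge0_muleDr// -addeA leeD2l//.
  rewrite [in leRHS]eqB ge0_integral_setU//; last 2 first.
  - exact: measurable_funTS.
  - apply/disj_setPS => w [] /[!BS]-[_ /= Mw] [_ /=].
    by rewrite leNgt Mw.
  rewrite addeC leeD//; first exact: superM.
  rewrite -integral_cst//; apply: ge0_le_integral => //.
  - by move=> w _; rewrite lee_fin ltW.
  - exact: measurable_funTS.
  - by move=> w [].
have -> : [set w | exists t, a%:E <= M t w] = \bigcup_n ~` B n.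
  apply/seteqP; split => w /= [t].
    by move=> Mt; exists t.+1 => //= /(_ t (ltnSn t)); rewrite ltNge Mt.
  move=> _ /= /existsNP[k /not_implyP[_ /negP]]; rewrite -leNgt => Mk.
  by exists k.
have cvgP : P (~` B n) @[n --> \oo] --> P (\bigcup_n ~` B n).
  apply: nondecreasing_cvg_mu => //.
  - by move=> n; exact: measurableC.
  - by apply: bigcup_measurable => n _; exact: measurableC.
  - move=> n m nm; apply/subsetPset; apply: subsetC => w Bw k kn.
    by apply: Bw; exact: leq_trans nm.
have cvgaP : a%:E * P (~` B n) @[n --> \oo] --> a%:E * P (\bigcup_n ~` B n).
  exact: cvgeZl.
rewrite -(cvg_lim _ cvgaP)//; apply: lime_le.
  by apply/cvg_ex; eexists; exact: cvgaP.
apply: nearW => n; apply: le_trans (step n); rewrite leeDl//.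
by apply: integral_ge0 => w _.
Qed.

(** * The compensated wealth as a nonnegative supermartingale *)

Lemma measurable_wrt_comp (T : pointedType) (G : set (set T))
    (d1 d2 : measure_display) (U : measurableType d1) (V : measurableType d2)
    (h : U -> V) (f : T -> U) :
  measurable_fun [set: U] h -> measurable_wrt G f -> measurable_wrt G (h \o f).
Proof.
move=> mh mf B mB; rewrite comp_preimage; apply: mf.
by rewrite -[X in measurable X]setTI; exact: mh.
Qed.

Lemma measurable_wrt_mule (T : pointedType) (R : realType) (G : set (set T))
    (f g : T -> \bar R) : sigma_algebra [set: T] G ->
  measurable_wrt G f -> measurable_wrt G g ->
  measurable_wrt G (fun w => f w * g w).
Proof.
by move=> sG /measurable_wrtP mf /measurable_wrtP mg;
  apply/measurable_wrtP => //; apply: emeasurable_funM; [exact: mf|exact: mg].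
Qed.

Lemma adapted_prode (d : measure_display) (T : measurableType d)
    (R : realType) (F : nat -> set (set T)) (f : nat -> T -> \bar R) t :
  is_filtration F -> (forall n, (0 < n)%N -> measurable_wrt (F n) (f n)) ->
  measurable_wrt (F t) (fun w => \big[*%E/1]_(1 <= n < t.+1) f n w).
Proof.
move=> HF mf; elim: t => [|t IH].
  under eq_fun do rewrite big_geq//.
  apply/measurable_wrtP; [exact: filtration_sigma|exact: measurable_cst].
under eq_fun do rewrite big_nat_recr//=.
apply: measurable_wrt_mule; [exact: filtration_sigma| |exact: mf].
by move=> B /IH; exact: filtration_incr.
Qed.

Lemma prode_ge0 (R : realType) (f : nat -> \bar R) t :
  (forall n, (0 < n)%N -> 0 <= f n) -> 0 <= \big[*%E/1]_(1 <= n < t.+1) f n.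
Proof.
move=> f0; elim: t => [|t IH]; first by rewrite big_geq.
by rewrite big_nat_recr//= mule_ge0// f0.
Qed.

(** One-step bound behind the supermartingale property, with [p] the majorant and [y] the
    conditional moment generating function. At [p = +oo] the left side is 0 even for [y = +oo]. *)
Lemma expeRN_lne_le1 (R : realType) (p y : \bar R) : 0 <= p -> 0 <= y ->
  lne y <= p -> expeR (- p) * y <= 1.
Proof.
move=> p0 y0 yp; have /eqP <- : expeR (lne y) == y by rewrite lneK_eq.
rewrite -expeRD -expeR0 lee_expeR addeC.
by case: p p0 yp => [r| |]// _ yp; [rewrite leeBlDr// add0e|rewrite addeNy].
Qed.

(** Kept as a product: the first factor is known at time n - 1 and can join a test function, the
    second is exactly the variable whose conditional expectation the majorant bounds. A majorant
    equal to +oo makes the factor 0. *)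
Definition compensated_factor (T : Type) (R : realType) (E : nat -> T -> \bar R)
    (c : nat -> T -> R) (psi : nat -> R -> T -> \bar R) (s : R) (n : nat)
    (w : T) : \bar R :=
  expeR (- psi n s w) * expeR (- (s%:E * (logE E n w - (c n w)%:E))).

Definition compensated_wealth (T : Type) (R : realType) (E : nat -> T -> \bar R)
    (c : nat -> T -> R) (psi : nat -> R -> T -> \bar R) (s : R) (t : nat)
    (w : T) : \bar R :=
  \big[*%E/1]_(1 <= n < t.+1) compensated_factor E c psi s n w.

Lemma compensated_wealth_ge0 (T : Type) (R : realType)
    (E : nat -> T -> \bar R) (c : nat -> T -> R)
    (psi : nat -> R -> T -> \bar R) (s : R) (t : nat) (w : T) :
  0 <= compensated_wealth E c psi s t w.
Proof. by apply: prode_ge0 => n _; rewrite mule_ge0// expeR_ge0. Qed.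

Lemma measurable_wrt_condmgf (d : measure_display) (T : measurableType d)
    (R : realType) (F : nat -> set (set T)) (P0 P1 : probability T R)
    (E : nat -> T -> \bar R) (c : nat -> T -> R) (s : R) (n : nat) :
  is_filtration F -> betting_sequence P0 F E -> drift_certificate P1 F E c ->
  (0 < n)%N ->
  measurable_wrt (F n)
    (fun w => expeR (- (s%:E * (logE E n w - (c n w)%:E)))).
Proof.
move=> HF HE Hc n0.
apply: (measurable_wrt_comp (@measurable_expeR R)).
have sF := filtration_sigma HF n.
have mc : measurable_wrt (F n) (c n).
  move=> B mB; apply: (filtrationW HF (leq_pred n)).
  exact: (drift_measurable Hc).
apply/measurable_wrtP => //; apply: measurableT_comp => //.
apply: measurable_funeM; apply: emeasurable_funB; last first.
  by apply/measurable_EFinP; apply/measurable_wrtP.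
apply: (measurableT_comp (@measurable_lne R)); apply/measurable_wrtP => //.
exact: (betting_measurable HE).
Qed.

Lemma compensated_wealth_adapted (d : measure_display) (T : measurableType d)
    (R : realType) (P0 P1 : probability T R) (F : nat -> set (set T))
    (E : nat -> T -> \bar R) (smax : \bar R) (c : nat -> T -> R)
    (psi : nat -> R -> T -> \bar R) (s : R) (t : nat) :
  is_filtration F -> betting_sequence P0 F E -> drift_certificate P1 F E c ->
  majorant P1 F E c smax psi -> tilts smax s ->
  measurable_wrt (F t) (compensated_wealth E c psi s t).
Proof.
move=> HF HE Hc Hpsi Hs; apply: adapted_prode => // n n0.
apply: measurable_wrt_mule; first exact: filtration_sigma.
  apply: (measurable_wrt_comp (h := fun x => expeR (- x))).
    exact: (measurableT_comp (@measurable_expeR R)).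
  move=> B mB; apply: (filtrationW HF (leq_pred n)).
  exact: (majorant_measurable Hpsi).
exact: measurable_wrt_condmgf HF HE Hc n0.
Qed.

(** The indicator of [A], the process at time t and the majorant factor form one [F t]-measurable
    test function [U]. Testing replaces the exponential of step t + 1 by its conditional expectation
    [Y], and [Y] times the majorant factor is at most 1 almost surely. *)
Lemma compensated_wealth_super (d : measure_display) (T : measurableType d)
    (R : realType) (P0 P1 : probability T R) (F : nat -> set (set T))
    (E : nat -> T -> \bar R) (smax : \bar R) (c : nat -> T -> R)
    (psi : nat -> R -> T -> \bar R) (s : R) (t : nat) (A : set T) :
  is_filtration F -> betting_sequence P0 F E -> drift_certificate P1 F E c ->
  majorant P1 F E c smax psi -> tilts smax s -> F t A ->
  \int[P1]_(w in A) compensated_wealth E c psi s t.+1 w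
    <= \int[P1]_(w in A) compensated_wealth E c psi s t w.
Proof.
move=> HF HE Hc Hpsi Hs FA.
have sF := filtration_sigma HF t.
have subF n := @filtration_sub _ _ _ HF n.
pose M := compensated_wealth E c psi s.
have M0 := compensated_wealth_ge0 E c psi s.
have mM n : measurable_wrt (F n) (M n).
  exact: (compensated_wealth_adapted n HF HE Hc Hpsi Hs).
pose X w := expeR (- (s%:E * (logE E t.+1 w - (c t.+1 w)%:E))).
have X0 w : 0 <= X w by exact: expeR_ge0.
have mX : measurable_fun [set: T] X.
  apply: (measurable_wrtW (@subF t.+1)).
  exact: measurable_wrt_condmgf HF HE Hc (ltn0Sn t).
have [phi [Y [mY Y0 YX] phiE] phi_le] := majorant_le Hpsi (ltn0Sn t) Hs.
pose U w := ((\1_A w)%:E * M t w) * expeR (- psi t.+1 s w).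
have indA0 w : 0 <= ((\1_A w)%:E : \bar R) by rewrite lee_fin.
have U0 w : 0 <= U w by rewrite !mule_ge0// expeR_ge0.
have mAM : measurable_wrt (F t) (fun w => (\1_A w)%:E * M t w).
  apply: measurable_wrt_mule => //; apply/measurable_wrtP => //.
  apply/measurable_EFinP; apply: measurable_indic.
  exact: sub_sigma_algebra.
have mU : measurable_wrt (F t) U.
  apply: measurable_wrt_mule => //.
  apply: (measurable_wrt_comp (h := fun x => expeR (- x))).
    exact: (measurableT_comp (@measurable_expeR R)).
  exact: (majorant_measurable Hpsi (ltn0Sn t) Hs).
have mY' : measurable_fun [set: T] Y by exact: measurable_wrtW mY.
have int_ind n : \int[P1]_(w in A) M n w = \int[P1]_w ((\1_A w)%:E * M n w).
  rewrite integral_mkcond epatch_indic.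
  by apply: eq_integral => w _; rewrite muleC.
rewrite !int_ind.
have -> : \int[P1]_w ((\1_A w)%:E * M t.+1 w) = \int[P1]_w (U w * X w).
  apply: eq_integral => w _; rewrite /M /compensated_wealth big_nat_recr//=.
  by rewrite /U /compensated_factor !muleA.
rewrite -(integral_test_fun sF (@subF t) mX mY' X0 Y0 YX mU U0).
apply: ae_ge0_le_integral => //.
- by move=> w _; rewrite mule_ge0.
- apply: emeasurable_funM => //; exact: measurable_wrtW mU.
- by move=> w _; rewrite mule_ge0// M0.
- exact: measurable_wrtW mAM.
- apply: filterS phi_le => w; rewrite phiE => Yw _.
  rewrite /U -muleA -[leRHS]mule1 lee_wpmul2l//; first by rewrite mule_ge0// M0.
  by apply: expeRN_lne_le1 => //; exact: (majorant_ge0 Hpsi).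
Qed.

Lemma compensated_wealth_integral_le1 (d : measure_display)
    (T : measurableType d)
    (R : realType) (P0 P1 : probability T R) (F : nat -> set (set T))
    (E : nat -> T -> \bar R) (smax : \bar R) (c : nat -> T -> R)
    (psi : nat -> R -> T -> \bar R) (s : R) (t : nat) :
  is_filtration F -> betting_sequence P0 F E -> drift_certificate P1 F E c ->
  majorant P1 F E c smax psi -> tilts smax s ->
  \int[P1]_w compensated_wealth E c psi s t w <= 1.
Proof.
move=> HF HE Hc Hpsi Hs; elim: t => [|t].
  under eq_integral do rewrite /compensated_wealth big_geq//.
  by rewrite integral_cst// mul1e probability_le1.
have FT : F t [set: T].
  by apply: (filtrationW HF (leq0n t)); rewrite (filtration0 HF); right.
exact/le_trans/(compensated_wealth_super HF HE Hc Hpsi Hs FT).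
Qed.

(** * Almost sure finiteness and positivity of the bets *)

Lemma betting_ae_lty (d : measure_display) (T : measurableType d)
    (R : realType) (P0 P1 : probability T R) (F : nat -> set (set T))
    (E : nat -> T -> \bar R) (n : nat) : is_filtration F ->
  (forall t A, F t A -> P0 A = 0 -> P1 A = 0) ->
  betting_sequence P0 F E -> (0 < n)%N ->
  {ae P1, forall w, E n w < +oo}.
Proof.
move=> HF Hac HE n0.
have sF := filtration_sigma HF.
have subF k := @filtration_sub _ _ _ HF k.
have E0 w : 0 <= E n w by exact: (betting_ge0 HE).
have mE : measurable_wrt (F n) (E n) by exact: (betting_measurable HE).
have mE' := measurable_wrtW (@subF n) mE.
have [Y [mY Y0 YE] Y1] := betting_fair HE n0.
have mY' := measurable_wrtW (@subF n.-1) mY.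
have intE : P0.-integrable [set: T] (E n).
  apply/integrableP; split => //.
  under eq_integral do rewrite gee0_abs//.
  rewrite -YE; last by apply: (filtrationW HF (leq0n _)); rewrite (filtration0 HF); right.
  apply: (@le_lt_trans _ _ (\int[P0]_w (cst 1 w))); last first.
    by rewrite integral_cst// mul1e -ge0_fin_numE// fin_num_measure.
  apply: ae_ge0_le_integral => //.
  by apply: filterS Y1 => w Yw _.
(* Absolute continuity is available only on each [F n], so the null set carried from [P0] to [P1]
   has to be this event of [F n]. *)
pose N := E n @^-1` [set +oo].
have FN : F n N by exact: mE.
exists N; split; [exact: subF FN| |].
  apply: (Hac n) => //; apply/negligibleP; first exact: subF FN.
  apply: negligibleS (integrable_ae measurableT intE) => w /= Nw.
  by move=> /(_ Logic.I); rewrite Nw.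
by move=> w /= /negP; rewrite -leNgt leye_eq => /eqP.
Qed.

(** The negative part of [L_n] need not be integrable, so the argument is localized. The drift bound
    makes its conditional expectation [Yn] finite almost surely; on each set [A k] of [F n.-1] where
    [Yn] is at most [k], the negative part has integral at most [k] and is thus finite almost
    surely, and the sets [A k] exhaust the event that [Yn] is finite. *)
Lemma drift_ae_gt0 (d : measure_display) (T : measurableType d)
    (R : realType) (P0 P1 : probability T R) (F : nat -> set (set T))
    (E : nat -> T -> \bar R) (c : nat -> T -> R) (n : nat) : is_filtration F ->
  betting_sequence P0 F E -> drift_certificate P1 F E c -> (0 < n)%N ->
  {ae P1, forall w, 0 < E n w}.
Proof.
move=> HF HE Hc n0.
have subF k := @filtration_sub _ _ _ HF k.
have mE' := measurable_wrtW (@subF n) (betting_measurable HE n0).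
have [Y [Yp [Yn [_ [mYn Yn0 YnL] _ _ YE]]] cY] := drift_le Hc n0.
have mYn' := measurable_wrtW (@subF n.-1) mYn.
have mL : measurable_fun [set: T] (logE E n)^\-.
  apply: measurable_funeneg.
  exact: (measurableT_comp (@measurable_lne R)).
pose A k := [set w | Yn w <= (k%:R : R)%:E].
have FA k : F n.-1 (A k).
  have -> : A k = Yn @^-1` `]-oo, k%:R%:E].
    by apply/seteqP; split => w /=; rewrite in_itv.
  by apply: mYn; exact: emeasurable_itv.
have mA k : measurable (A k) by exact: subF (FA k).
have fin k : {ae P1, forall w, A k w -> (logE E n)^\- w \is a fin_num}.
  apply: integrable_ae => //; apply/integrableP; split.
    exact: measurable_funTS.
  under eq_integral do rewrite gee0_abs//.
  rewrite -YnL//.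
  apply: (@le_lt_trans _ _ (\int[P1]_(w in A k) (cst k%:R%:E w))).
    apply: ge0_le_integral => //; exact: measurable_funTS.
  rewrite integral_cst// lte_mul_pinfty// ?lee_fin// -ge0_fin_numE//.
  exact: fin_num_measure.
have := ae_foralln fin.
apply: filterS3 YE cY => w Yw cw Aw.
have Ynw : Yn w < +oo.
  (* An infinite [Yn w] would make [Yp w - Yn w] equal to -oo whatever [Yp w] is, against the real
     lower bound [c n w]. *)
  rewrite ltey; apply/eqP => Ynw; move: cw; rewrite Yw Ynw.
  by case: (Yp w).
have [k Ak] : exists k, A k w.
  move: Ynw (Yn0 w); rewrite /A /=; case: (Yn w) => [r| |]// _; rewrite lee_fin => r0.
  exists (Num.bound r); rewrite lee_fin ltW//.
  by have := archi_boundP r0.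
have := Aw k Ak; rewrite funenegE /logE.
apply: contraTT; rewrite -leNgt => /le0_lneNy ->.
by rewrite (_ : - -oo = +oo)// maxye.
Qed.

Lemma betting_ae_regular (d : measure_display) (T : measurableType d)
    (R : realType) (P0 P1 : probability T R) (F : nat -> set (set T))
    (E : nat -> T -> \bar R) (c : nat -> T -> R) : is_filtration F ->
  (forall t A, F t A -> P0 A = 0 -> P1 A = 0) ->
  betting_sequence P0 F E -> drift_certificate P1 F E c ->
  {ae P1, forall w n, (0 < n)%N -> 0 < E n w < +oo}.
Proof.
move=> HF Hac HE Hc.
have reg n : {ae P1, forall w, 0 < E n.+1 w < +oo}.
  have := drift_ae_gt0 HF HE Hc (ltn0Sn n).
  have := betting_ae_lty HF Hac HE (ltn0Sn n).
  by apply: filterS2 => w -> ->.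
have := ae_foralln reg; apply: filterS => w rw [|n] // _; exact: rw.
Qed.

(** * Negative moments of the wealth *)

(** The exit from extended arithmetic: for regular bets and a finite sum of majorants both processes
    are exponentials of real numbers, with [L] the log-wealth, and later comparisons become linear
    in the exponents. *)
Lemma compensated_wealthE (T : Type) (R : realType) (E : nat -> T -> \bar R)
    (c : nat -> T -> R) (psi : nat -> R -> T -> \bar R) (s : R) (t : nat)
    (w : T) :
  (forall n, (0 < n)%N -> 0 < E n w < +oo) ->
  (forall n, (0 < n)%N -> 0 <= psi n s w) ->
  \sum_(1 <= n < t.+1) psi n s w < +oo ->
  exists2 L : R, wealth E t w = (expR L)%:E &
    compensated_wealth E c psi s t w =
    (expR (- (s * (L - \sum_(1 <= n < t.+1) c n w))
           - fine (\sum_(1 <= n < t.+1) psi n s w)))%:E.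
Proof.
move=> Ereg psi0; rewrite /wealth /compensated_wealth.
elim: t => [|t IH].
  by exists 0%R; rewrite !big_geq//= ?(subr0, mulr0, oppr0, expR0).
have sum0 : 0 <= \sum_(1 <= n < t.+1) psi n s w.
  rewrite big_nat_cond; apply: sume_ge0 => n.
  by rewrite andbT => /andP[n0 _]; exact: psi0.
rewrite !(@big_nat_recr _ _ _ t.+1 1)//= => sumy.
have psit := psi0 _ (ltn0Sn t).
have sum_fin : \sum_(1 <= n < t.+1) psi n s w \is a fin_num.
  by rewrite ge0_fin_numE//; apply: le_lt_trans sumy; rewrite leeDl.
have psi_fin : psi t.+1 s w \is a fin_num.
  by rewrite ge0_fin_numE//; apply: le_lt_trans sumy; rewrite leeDr.
have [|L -> ->] := IH; first by rewrite -ge0_fin_numE.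
have /andP[Et0 Ety] := Ereg _ (ltn0Sn t).
exists (L + ln (fine (E t.+1 w)))%R.
  rewrite expRD EFinM lnK ?fineK ?ge0_fin_numE ?ltW//.
  by rewrite posrE fine_gt0// Et0.
rewrite /compensated_factor /logE.
move: psi_fin sum_fin Et0 Ety; case: (psi t.+1 s w) => [p| |]// _.
case: (\sum_(_ <= _ < _) psi _ _ _) => [q| |]// _.
case: (E t.+1 w) => [e| |]//; rewrite lte_fin => e0 _.
rewrite lne_EFin//=  -!EFinM -!expRD; congr (expR _)%:E; ring.
Qed.

Lemma fine_le_EFin (R : realType) (x : \bar R) (K : R) :
  0 <= x -> x <= K%:E -> (fine x <= K)%R.
Proof. by case: x. Qed.

Lemma sume_range_ge0 (R : realType) (f : nat -> \bar R) t :
  (forall n, (0 < n)%N -> 0 <= f n) -> 0 <= \sum_(1 <= n < t.+1) f n.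
Proof.
move=> f0; rewrite big_nat_cond; apply: sume_ge0 => n.
by rewrite andbT => /andP[n0 _]; exact: f0.
Qed.

Lemma negpow_expR (R : realType) (L s : R) :
  negpow (expR L)%:E s = (expR (- (s * L)))%:E.
Proof.
rewrite /negpow; have [->|s0] := eqVneq s 0%R.
  by rewrite mul0r oppr0 expR0.
by rewrite gt_eqF ?expR_gt0// -expRM mulrN mulrC.
Qed.

Lemma prode_gt0 (R : realType) (f : nat -> \bar R) t :
  (forall n, (0 < n)%N -> 0 < f n) -> 0 < \big[*%E/1]_(1 <= n < t.+1) f n.
Proof.
move=> f0; elim: t => [|t IH]; first by rewrite big_geq.
by rewrite big_nat_recr//= mule_gt0// f0.
Qed.

Lemma wealth_ge0 (d : measure_display) (T : measurableType d)
    (R : realType) (P0 : probability T R) (F : nat -> set (set T))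
    (E : nat -> T -> \bar R) (t : nat) (w : T) :
  betting_sequence P0 F E -> 0 <= wealth E t w.
Proof. by move=> HE; apply: prode_ge0 => n n0; exact: (betting_ge0 HE). Qed.

Lemma measurable_wealth (d : measure_display) (T : measurableType d)
    (R : realType) (P0 : probability T R) (F : nat -> set (set T))
    (E : nat -> T -> \bar R) (t : nat) :
  is_filtration F -> betting_sequence P0 F E ->
  measurable_fun [set: T] (wealth E t).
Proof.
move=> HF HE; apply: (measurable_wrtW (@filtration_sub _ _ _ HF t)).
by apply: adapted_prode => // n; exact: (betting_measurable HE).
Qed.

Lemma negative_moment (d : measure_display) (T : measurableType d)
    (R : realType) (P0 P1 : probability T R) (F : nat -> set (set T))
    (E : nat -> T -> \bar R) (smax : \bar R) (c : nat -> T -> R)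
    (psi : nat -> R -> T -> \bar R) (C : nat -> R) (Psi : nat -> R -> \bar R)
    (t : nat) (s : R) :
  is_filtration F -> (forall t A, F t A -> P0 A = 0 -> P1 A = 0) ->
  betting_sequence P0 F E -> drift_certificate P1 F E c ->
  majorant P1 F E c smax psi -> aggregate P1 c smax psi C Psi ->
  (0 < t)%N -> tilts smax s ->
  \int[P1]_w negpow (wealth E t w) s <= expeR (- (s * C t)%:E + Psi t s).
Proof.
move=> HF Hac HE Hc Hpsi Hagg t0 Hs.
have := aggregate_ge0 Hagg t0 Hs; have := aggregate_le Hagg t0 Hs.
case: (Psi t s) => [K| |]//; last by move=> _ _; rewrite leey.
move=> agg K0.
have mM := measurable_wrtW (@filtration_sub _ _ _ HF t)
  (compensated_wealth_adapted t HF HE Hc Hpsi Hs).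
(* The deterministic price for replacing the sums of [c] and [psi] by [C t] and [K]: almost surely
   [W_t^{-s}] is at most [b] times [M_t]. *)
pose b := expR (- (s * C t) + K).
apply: (@le_trans _ _ (\int[P1]_w (b%:E * compensated_wealth E c psi s t w))).
  apply: ae_ge0_le_integral => //.
  - by move=> w _; exact: negpow_ge0.
  - by apply: (measurableT_comp (@measurable_negpow R s));
      exact: measurable_wealth HF HE.
  - by move=> w _; rewrite mule_ge0 ?lee_fin ?expR_ge0// compensated_wealth_ge0.
  - exact: measurable_funeM.
  apply: filterS2 (betting_ae_regular HF Hac HE Hc) agg => w Ew [cw psiw] _.
  have psi0 n : (0 < n)%N -> 0 <= psi n s w.
    by move=> n0; exact: (majorant_ge0 Hpsi).
  have [|L -> ->] := compensated_wealthE c Ew psi0 (t := t).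
    by apply: le_lt_trans psiw _; rewrite ltry.
  have sumK : (fine (\sum_(1 <= n < t.+1) psi n s w) <= K)%R.
    by apply: fine_le_EFin => //; exact: sume_range_ge0.
  rewrite negpow_expR -EFinM -expRD lee_fin ler_expR.
  have : (0 <= s * (\sum_(1 <= n < t.+1) c n w - C t))%R.
    by rewrite mulr_ge0 ?subr_ge0//; case: Hs.
  lra.
rewrite ge0_integralZl//; last 2 first.
- by move=> w _; exact: compensated_wealth_ge0.
- by rewrite lee_fin expR_ge0.
rewrite -[leRHS]mule1 lee_wpmul2l ?lee_fin ?expR_ge0//.
exact: (compensated_wealth_integral_le1 t HF HE Hc Hpsi Hs).
Qed.

(** * Time-uniform lower bound on the log-wealth *)

Lemma aggregate_ae (d : measure_display) (T : measurableType d)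
    (R : realType) (P1 : probability T R) (c : nat -> T -> R) (smax : \bar R)
    (psi : nat -> R -> T -> \bar R) (C : nat -> R) (Psi : nat -> R -> \bar R)
    (s : R) : aggregate P1 c smax psi C Psi -> tilts smax s ->
  {ae P1, forall w t, (C t <= \sum_(1 <= n < t.+1) c n w)%R /\
                      \sum_(1 <= n < t.+1) psi n s w <= Psi t s}.
Proof.
move=> Hagg Hs; apply: ae_foralln => -[|t]; last exact: (aggregate_le Hagg (ltn0Sn t) Hs).
(* At time 0 the sums are empty and the conventions on [C] and [Psi] apply; this is how time 0
   enters the uniform statement. *)
apply: aeW => w.
by split; rewrite big_geq// ?(aggregate_C0 Hagg) ?(aggregate_Psi0 Hagg Hs).
Qed.

Lemma le_measure_ae (d : measure_display) (T : measurableType d)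
    (R : realType) (mu : {measure set T -> \bar R}) (A B : set T) :
  measurable A -> measurable B -> {ae mu, forall w, A w -> B w} ->
  mu A <= mu B.
Proof.
move=> mA mB [N [mN N0 sub]].
rewrite -(measureU0 mB mN N0); apply: le_measure; rewrite ?inE//.
  exact: measurableU.
move=> w Aw; have [Bw|nB] := pselect (B w); first by left.
by right; apply: sub => /= /(_ Aw).
Qed.

(** Off the event that [M_t] ever reaches [delta^-1], of probability at most [delta], one has
    [M_t < delta^-1] strictly; logarithms and division by [s] preserve strictness. The measurability
    of the event is reused for the rejection time. *)
Lemma log_wealth_uniform (d : measure_display) (T : measurableType d)
    (R : realType) (P0 P1 : probability T R) (F : nat -> set (set T))
    (E : nat -> T -> \bar R) (smax : \bar R) (c : nat -> T -> R)
    (psi : nat -> R -> T -> \bar R) (C : nat -> R) (Psi : nat -> R -> \bar R)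
    (s delta : R) :
  is_filtration F -> (forall t A, F t A -> P0 A = 0 -> P1 A = 0) ->
  betting_sequence P0 F E -> drift_certificate P1 F E c ->
  majorant P1 F E c smax psi -> aggregate P1 c smax psi C Psi ->
  pos_tilts smax s -> (0 < delta < 1)%R ->
  measurable [set w | forall t : nat,
             (C t)%:E - (s^-1)%:E * (Psi t s + (ln (delta^-1))%:E)
               < lne (wealth E t w)] /\
  (1 - delta)%:E <=
       P1 [set w | forall t : nat,
             (C t)%:E - (s^-1)%:E * (Psi t s + (ln (delta^-1))%:E)
               < lne (wealth E t w)].
Proof.
move=> HF Hac HE Hc Hpsi Hagg [s0 smaxs] /andP[delta0 delta1].
have Hs : tilts smax s by split => //; exact: ltW.
have a0 : (0 < delta^-1)%R by rewrite invr_gt0.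
set S := [set w | _].
pose M := compensated_wealth E c psi s.
have mMF n := compensated_wealth_adapted n HF HE Hc Hpsi Hs.
have mM n := measurable_wrtW (@filtration_sub _ _ _ HF n) (mMF n).
have mS : measurable S.
  rewrite (_ : S = \bigcap_t [set w |
      (C t)%:E - (s^-1)%:E * (Psi t s + (ln (delta^-1))%:E)
               < lne (wealth E t w)]); last first.
    by apply/seteqP; split => w /= Sw t *; exact: Sw.
  apply: bigcap_measurable => // t _; rewrite -[X in measurable X]setTI.
  apply: emeasurable_fun_o_infty => //.
  apply: (measurableT_comp (@measurable_lne R)).
  exact: measurable_wealth HF HE.
split=> //.
pose bad := [set w | exists t, (delta^-1)%:E <= M t w].
have mbad : measurable bad.
  rewrite (_ : bad = \bigcup_t [set w | (delta^-1)%:E <= M t w]); last first.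
    by apply/seteqP; split => w [] => [t|t _] Mt; exists t.
  apply: bigcup_measurable => t _; rewrite -[X in measurable X]setTI.
  exact: emeasurable_fun_c_infty.
have Pbad : P1 bad <= delta%:E.
  have := ville_inequality HF a0 mMF (fun n w => compensated_wealth_ge0 E c psi s n w)
    (fun n A => @compensated_wealth_super _ _ _ P0 P1 F E smax c psi s n A HF HE Hc Hpsi Hs).
  move=> /le_trans/(_ (compensated_wealth_integral_le1 0 HF HE Hc Hpsi Hs)).
  by rewrite -/M -/bad muleC lee_pdivrMr// mul1e.
apply: (@le_trans _ _ (P1 (~` bad))).
  by rewrite probability_setC// EFinB leeB.
apply: le_measure_ae => //; first exact: measurableC.
apply: filterS2 (betting_ae_regular HF Hac HE Hc) (aggregate_ae Hagg Hs).
move=> w Ew aggw nbad t.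
have [cw psiw] := aggw t.
have M1 : M t w < (delta^-1)%:E.
  by rewrite ltNge; apply/negP => Mt; apply: nbad; exists t.
have psi0 n : (0 < n)%N -> 0 <= psi n s w.
  by move=> n0; exact: (majorant_ge0 Hpsi).
have W0 : 0 < wealth E t w by apply: prode_gt0 => n /Ew /andP[].
move: psiw; case: (Psi t s) => [K| |] psiw.
- have [|L WL ML] := compensated_wealthE c Ew psi0 (t := t).
    by apply: le_lt_trans psiw _; rewrite ltry.
  have sumK : (fine (\sum_(1 <= n < t.+1) psi n s w) <= K)%R.
    by apply: fine_le_EFin => //; exact: sume_range_ge0.
  rewrite WL lne_EFin ?expR_gt0// expRK.
  rewrite -[ltLHS]/((C t - s^-1 * (K + ln delta^-1))%:E) lte_fin.
  move: M1; rewrite /M ML lte_fin -ltr_ln ?posrE ?expR_gt0// expRK.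
  set S1 := fine _; set l := ln _; set S2 := (\sum_(_ <= _ < _) _)%R => Ml.
  rewrite ltrBlDr -ltrBlDl mulrC ltr_pdivlMr//.
  have : (0 <= s * (S2 - C t))%R by rewrite mulr_ge0 ?subr_ge0// ltW.
  rewrite -/S1 in sumK; lra.
(* For [Psi t s = +oo] the claimed lower bound is -oo, and positive wealth has a logarithm above
   -oo. *)
- rewrite addye// gt0_muley ?lte_fin ?invr_gt0// addeNy.
  by case: (wealth E t w) W0 => // r; rewrite lte_fin => r0; rewrite lne_EFin// ltNyr.
- by move: psiw; rewrite leeNy_eq => /eqP S0; have := sume_range_ge0 t psi0; rewrite S0.
Qed.

(** * First times, type-II errors and the rejection time *)

Lemma first_time_attained (R : realType) (A : nat -> Prop) (t : nat) :
  (0 < t)%N -> A t -> exists k, [/\ (0 < k <= t)%N, A k &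
  first_time R A = (k%:R)%:E].
Proof.
move=> t0 At.
have ex : exists k, `[< (0 < k)%N /\ A k >] by exists t; apply/asboolP.
case: (ex_minnP ex) => k /asboolP[k0 Ak] kmin.
exists k; split => //; first by rewrite k0 kmin//; apply/asboolP.
apply/eqP; rewrite eq_le; apply/andP; split.
  by apply: ereal_inf_lbound; exists k.
apply: le_ereal_inf_tmp => _ [j [j0 Aj] <-].
by rewrite lee_fin ler_nat; apply: kmin; apply/asboolP.
Qed.

(** Reduces events about an extended-real infimum to conditions at finitely many times, which makes
    them measurable. *)
Lemma first_time_le (R : realType) (A : nat -> Prop) (t : nat) :
  first_time R A <= (t%:R)%:E <-> exists2 k, (0 < k <= t)%N & A k.
Proof.
split=> [|[k /andP[k0 kt] Ak]]; last first.
  apply: (@le_trans _ _ (k%:R)%:E); last by rewrite lee_fin ler_nat.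
  by apply: ereal_inf_lbound; exists k.
move=> fle; have [j [j0 Aj]] : exists j, (0 < j)%N /\ A j.
  apply: contrapT => nA; move: fle.
  rewrite /first_time (_ : [set t | _] = set0) ?image_set0 ?ereal_inf0//.
  by apply/seteqP; split => j // jA; apply: nA; exists j.
have [k [/andP[k0 _] Ak fk]] := first_time_attained R j0 Aj.
by exists k => //; move: fle; rewrite fk lee_fin ler_nat k0.
Qed.

Lemma type2_seq_le_fixed (d : measure_display) (T : measurableType d)
    (R : realType) (P0 P1 : probability T R) (F : nat -> set (set T))
    (E : nat -> T -> \bar R) (alpha : R) (t : nat) :
  is_filtration F -> betting_sequence P0 F E -> (0 < t)%N ->
  type2_seq P1 E alpha t <= type2_fixed P1 E alpha t.
Proof.
move=> HF HE t0.
have mW k : measurable [set w | wealth E k w <= (alpha^-1)%:E].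
  rewrite -[X in measurable X]setTI.
  by apply: emeasurable_fun_infty_c => //; exact: measurable_wealth HF HE.
have eqS : [set w | (t%:R)%:E < rejection_time E alpha w] =
    \bigcap_(k in [set k | (0 < k <= t)%N])
      [set w | wealth E k w <= (alpha^-1)%:E].
  apply/seteqP; split => w /=.
    move=> tw k /= kt; rewrite leNgt; apply/negP => Wk; move: tw.
    rewrite ltNge => /negP; apply; apply/first_time_le; by exists k.
  move=> Ww; rewrite ltNge; apply/negP => /first_time_le[k kt].
  by rewrite ltNge Ww.
rewrite /type2_seq eqS; apply: le_measure; rewrite ?inE//.
  apply: bigcap_measurable => //.
  by exists t; rewrite /= t0 leqnn.
by move=> w; apply => /=; rewrite t0 leqnn.
Qed.

Lemma type2_fixed_le (d : measure_display) (T : measurableType d)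
    (R : realType) (P0 P1 : probability T R) (F : nat -> set (set T))
    (E : nat -> T -> \bar R) (smax : \bar R) (c : nat -> T -> R)
    (psi : nat -> R -> T -> \bar R) (C : nat -> R) (Psi : nat -> R -> \bar R)
    (t : nat) (alpha : R) :
  is_filtration F -> (forall t A, F t A -> P0 A = 0 -> P1 A = 0) ->
  betting_sequence P0 F E -> drift_certificate P1 F E c ->
  majorant P1 F E c smax psi -> aggregate P1 c smax psi C Psi ->
  (0 < t)%N -> (0 < alpha < 1)%R ->
  type2_fixed P1 E alpha t <= expeR (- rate smax (Psi t) (deviation C alpha t)).
Proof.
move=> HF Hac HE Hc Hpsi Hagg t0 /andP[alpha0 alpha1].
set l := ln (alpha^-1).
set Delta := deviation C alpha t.
pose A := [set w | wealth E t w <= (alpha^-1)%:E].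
have mWt := measurable_wealth t HF HE.
have mA : measurable A.
  by rewrite -[X in measurable X]setTI; exact: emeasurable_fun_infty_c.
have bound s : tilts smax s -> P1 A <= expeR (- ((s * Delta)%:E - Psi t s)).
  move=> Hs; have [sge0 _] := Hs.
  have Psi0 := aggregate_ge0 Hagg t0 Hs.
  have -> : - ((s * Delta)%:E - Psi t s) = (- (s * Delta))%:E + Psi t s.
    by case: (Psi t s) Psi0 => [K| |]//= _; congr _%:E; rewrite opprB addrC.
  (* Below the threshold the truncation gives [Delta = 0] and the bound is at least 1. Above it,
     Markov's inequality for [W_t^{-s}] gives the exponent [s * l - s * C t + Psi t s]. *)
  have [Cl|lC] := leP (C t) l.
    have -> : Delta = 0%R by rewrite /Delta /deviation max_r// subr_le0.
    rewrite mulr0 oppr0 add0e; apply: (@le_trans _ _ 1).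
      exact: probability_le1.
    by rewrite -expeR0 lee_expeR.
  have -> : Delta = (C t - l)%R.
    by rewrite /Delta /deviation max_l// subr_ge0 ltW.
  have lowA w : A w -> (expR (- (s * l)))%:E <= negpow (wealth E t w) s.
    rewrite /A /=; have := wealth_ge0 t w HE.
    case: (wealth E t w) => [r| |]//; rewrite !lee_fin le_eqVlt => /predU1P[<-|r0] rl.
      rewrite /negpow eqxx; case: eqP => [->|_]; last by rewrite leey.
      by rewrite mul0r oppr0 expR0.
    rewrite -[r in leRHS]lnK ?posrE// negpow_expR lee_fin ler_expR lerN2.
    by rewrite ler_wpM2l// ler_ln ?posrE// invr_gt0.
  have low : (expR (- (s * l)))%:E * P1 A <= expeR (- (s * C t)%:E + Psi t s).
    apply: le_trans (negative_moment HF Hac HE Hc Hpsi Hagg t0 Hs).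
    have mN : measurable_fun [set: T] (fun w => negpow (wealth E t w) s).
      exact: (measurableT_comp (@measurable_negpow R s)).
    apply: (@le_trans _ _ (\int[P1]_(w in A) negpow (wealth E t w) s)).
      rewrite -integral_cst//; apply: ge0_le_integral => //.
      - by move=> w _; rewrite lee_fin expR_ge0.
      - exact: measurable_funTS.
    by apply: ge0_subset_integral => // w _; exact: negpow_ge0.
  rewrite -(@lee_pmul2l _ (expR (- (s * l)))%:E) ?lte_fin ?expR_gt0//.
  apply: le_trans low _; rewrite -[(expR _)%:E]/(expeR (- (s * l))%:E) -expeRD.
  by rewrite lee_expeR addeA leeD2r// -EFinN lee_fin; lra.
(* In logarithmic form the bounds for all tilts make [- lne (P1 A)] an upper bound of the set
   defining the rate; [P1 A = 0] is covered, the upper bound then being +oo. *)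
have rate_le : rate smax (Psi t) Delta <= - lne (P1 A).
  apply: ge_ereal_sup => _ [s Hs <-].
  rewrite leeNr -lee_expeR.
  have /eqP -> : expeR (lne (P1 A)) == P1 A by rewrite lneK_eq.
  exact: bound.
have /eqP PA : expeR (lne (P1 A)) == P1 A by rewrite lneK_eq.
by rewrite /type2_fixed -/A -PA lee_expeR leeNr.
Qed.

Lemma rejection_time_le_horizon (d : measure_display) (T : measurableType d)
    (R : realType) (P0 P1 : probability T R) (F : nat -> set (set T))
    (E : nat -> T -> \bar R) (smax : \bar R) (c : nat -> T -> R)
    (psi : nat -> R -> T -> \bar R) (C : nat -> R) (Psi : nat -> R -> \bar R)
    (s delta alpha : R) :
  is_filtration F -> (forall t A, F t A -> P0 A = 0 -> P1 A = 0) ->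
  betting_sequence P0 F E -> drift_certificate P1 F E c ->
  majorant P1 F E c smax psi -> aggregate P1 c smax psi C Psi ->
  pos_tilts smax s -> (0 < delta < 1)%R -> (0 < alpha < 1)%R ->
  (1 - delta)%:E <=
    P1 [set w | rejection_time E alpha w
                  <= rejection_horizon C Psi alpha s delta].
Proof.
move=> HF Hac HE Hc Hpsi Hagg Hs Hdelta /andP[alpha0 alpha1].
have [mS PS] := log_wealth_uniform HF Hac HE Hc Hpsi Hagg Hs Hdelta.
have [s0 smaxs] := Hs.
rewrite /rejection_horizon; set H := (fun t : nat => _).
(* If no time meets the condition, the horizon is +oo and the event is the whole space. Otherwise
   the infimum is attained at a deterministic [t], and the uniform bound is used at this [t]. *)
have [[j [j0 Hj]]|nH] := pselect (exists j, (0 < j)%N /\ H j); last first.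
  have -> : first_time R H = +oo.
    rewrite /first_time (_ : [set t | _] = set0) ?image_set0 ?ereal_inf0//.
    by apply/seteqP; split => j // jH; apply: nH; exists j.
  rewrite (_ : [set w | _] = setT) ?probability_setT ?lee_fin.
    by case/andP: Hdelta => delta0 _; rewrite lerBlDr lerDl ltW.
  by apply/seteqP; split => w //= _; rewrite leey.
have [t [/andP[t0 _] Ht ->]] := first_time_attained R j0 Hj.
apply: (le_trans PS); apply: le_measure; rewrite ?inE//.
  rewrite (_ : [set w | _] = \bigcup_(k in [set k | (0 < k <= t)%N])
      [set w | (alpha^-1)%:E < wealth E k w]).
    apply: bigcup_measurable => k _; rewrite -[X in measurable X]setTI.
    by apply: emeasurable_fun_o_infty => //; exact: measurable_wealth HF HE.
  by apply/seteqP; split => w /= /first_time_le.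
move=> w /(_ t) Wt; apply/first_time_le; exists t; first by rewrite t0 /=.
have Psi0 := aggregate_ge0 Hagg t0 (conj (ltW s0) smaxs).
move: Ht Wt; rewrite /H; case: (Psi t s) Psi0 => [K| |]// K0.
rewrite -EFinD lee_fin => Ht.
set x := _ - _; have -> : x = (C t - s^-1 * (K + ln delta^-1))%:E by [].
move=> Wt; have W0 := wealth_ge0 t w HE.
rewrite -lte_lne; last 2 first.
- by rewrite in_itv/= lee_fin invr_ge0 ltW//= leey.
- by rewrite in_itv/= W0 leey.
rewrite lne_EFin ?invr_gt0//; apply: le_lt_trans Wt.
rewrite lee_fin lerBrDr -lerBrDl mulrC ler_pdivrMr//; lra.
Qed.

(** * Chords, tangents and slopes of strictly convex functions *)

Lemma derive1_cvg_right (R : realType) (f : R -> R) (x : R) :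
  derivable f x 1%R ->
  (h^-1 * (f (h + x) - f x))%R @[h --> 0%R^'+] --> derive1 f x.
Proof.
move=> df; apply: cvg_dnbhs_at_right; rewrite derive1E.
apply: cvg_trans df; apply: near_eq_cvg.
by near=> h; rewrite /= /GRing.scale/= mulr1.
Unshelve. all: by end_near. Qed.

Lemma derive1_cvg_left (R : realType) (f : R -> R) (x : R) :
  derivable f x 1%R ->
  (h^-1 * (f (h + x) - f x))%R @[h --> 0%R^'-] --> derive1 f x.
Proof.
move=> df; apply: cvg_dnbhs_at_left; rewrite derive1E.
apply: cvg_trans df; apply: near_eq_cvg.
by near=> h; rewrite /= /GRing.scale/= mulr1.
Unshelve. all: by end_near. Qed.

Lemma pos_tilts_itv (R : realType) (smax : \bar R) (x y z : R) :
  pos_tilts smax x -> pos_tilts smax y -> (x <= z <= y)%R -> pos_tilts smax z.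
Proof.
move=> [x0 _] [_ ym] /andP[xz zy]; split; first exact: lt_le_trans xz.
by apply: le_lt_trans ym; rewrite lee_fin.
Qed.

Lemma strictly_convex_chord (R : realType) (smax : \bar R) (f : R -> R)
    (a b c : R) : strictly_convex_on (pos_tilts smax) f ->
  pos_tilts smax a -> pos_tilts smax c -> (a < b < c)%R ->
  ((c - a) * f b < (c - b) * f a + (b - a) * f c)%R.
Proof.
move=> fcvx Ia Ic /andP[ab bc].
have ac : (0 < c - a)%R by rewrite subr_gt0 (lt_trans ab).
have p01 : (0 < (c - b) / (c - a) < 1)%R.
  apply/andP; split; first by rewrite divr_gt0// subr_gt0.
  by rewrite ltr_pdivrMr// mul1r ltrD2l ltrN2.
have aNc : a != c by rewrite lt_eqF// (lt_trans ab).
have := fcvx a c _ Ia Ic aNc p01.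
have -> : ((c - b) / (c - a) * a + (1 - (c - b) / (c - a)) * c = b)%R.
  by field; rewrite gt_eqF.
rewrite -(ltr_pM2l ac); congr (_ < _)%R.
by field; rewrite gt_eqF.
Qed.

(** By the chord inequality, difference quotients at [x] taken towards [y] compare with the slope of
    the chord from [x] to [y]; the limit keeps the comparison but not its strictness. *)
Lemma strictly_convex_tangent_weak (R : realType) (smax : \bar R) (f : R -> R)
    (x y : R) : strictly_convex_on (pos_tilts smax) f ->
  pos_tilts smax x -> pos_tilts smax y -> derivable f x 1%R ->
  (derive1 f x * (y - x) <= f y - f x)%R.
Proof.
move=> fcvx Ix Iy df; have [xy|yx|->] := ltgtP x y; last by rewrite !subrr mulr0.
- have yx0 : (0 < y - x)%R by rewrite subr_gt0.
  rewrite -ler_pdivlMr//; apply: (cvgr_to_le (derive1_cvg_right df)).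
  near=> h.
  have h0 : (0 < h)%R by near: h; exact: nbhs_right_gt.
  have hy : (h < y - x)%R by near: h; exact: nbhs_right_lt.
  have xhy : (x < h + x < y)%R by rewrite ltrDr h0/= -ltrBrDr.
  have := strictly_convex_chord fcvx Ix Iy xhy.
  by rewrite ler_pdivlMr// [(h^-1 * _)%R]mulrC mulrAC ler_pdivrMr//; nra.
- have yx0 : (0 < x - y)%R by rewrite subr_gt0.
  rewrite -opprB mulrN -[leRHS]opprB lerN2 -ler_pdivrMr//.
  apply: (cvgr_to_ge (derive1_cvg_left df)).
  near=> h.
  have h0 : (h < 0)%R by near: h; exact: nbhs_left_lt.
  have hy : (y - x < h)%R by near: h; apply: nbhs_left_gt; rewrite subr_lt0.
  have xhy : (y < h + x < x)%R by rewrite gtrDr h0 andbT -ltrBlDr.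
  have := strictly_convex_chord fcvx Iy Ix xhy.
  by rewrite ler_pdivrMr// [(h^-1 * _)%R]mulrC mulrAC ler_ndivlMr//; nra.
Unshelve. all: by end_near. Qed.

(* The weak inequality at the midpoint of [x, y] is already strict at [y]. *)
Lemma strictly_convex_tangent (R : realType) (smax : \bar R) (f : R -> R)
    (x y : R) : strictly_convex_on (pos_tilts smax) f ->
  pos_tilts smax x -> pos_tilts smax y -> derivable f x 1%R -> x != y ->
  (derive1 f x * (y - x) < f y - f x)%R.
Proof.
move=> fcvx Ix Iy df xy.
pose m := (2^-1 * x + (1 - 2^-1) * y)%R.
have fm : (f m < 2^-1 * f x + (1 - 2^-1) * f y)%R.
  by apply: fcvx => //; apply/andP; split; lra.
have Im : pos_tilts smax m.
  have [xy'|yx'] := leP x y.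
    by apply: (pos_tilts_itv Ix Iy); apply/andP; split; rewrite /m; lra.
  by apply: (pos_tilts_itv Iy Ix); apply/andP; split; rewrite /m; lra.
have := strictly_convex_tangent_weak fcvx Ix Im df.
have -> : (m - x = 2^-1 * (y - x))%R by rewrite /m; field.
rewrite mulrCA; lra.
Qed.

(** Adding the strict tangent inequalities at [x] and at [y] cancels the values of [f]. *)
Lemma strictly_convex_derive1_lt (R : realType) (smax : \bar R) (f : R -> R)
    (x y : R) : strictly_convex_on (pos_tilts smax) f ->
  (forall s, pos_tilts smax s -> derivable f s 1%R) ->
  pos_tilts smax x -> pos_tilts smax y -> (x < y)%R ->
  (derive1 f x < derive1 f y)%R.
Proof.
move=> fcvx df Ix Iy xy.
have xNy : x != y by rewrite lt_eqF.
have := strictly_convex_tangent fcvx Ix Iy (df x Ix) xNy.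
have := strictly_convex_tangent fcvx Iy Ix (df y Iy).
rewrite eq_sym => /(_ xNy) h1 h2.
have : (0 < y - x)%R by rewrite subr_gt0.
nra.
Qed.

(** * Limits at the two ends of the tilt range *)

Lemma pos_tilts_inhabited (R : realType) (smax : \bar R) : 0 < smax ->
  exists2 e : R, (0 < e)%R & forall s, (0 < s <= e)%R -> pos_tilts smax s.
Proof.
case: smax => [r| |]//.
- rewrite lte_fin => r0; exists (r / 2)%R; first by rewrite divr_gt0.
  move=> s /andP[s0 sr]; split => //; rewrite lte_fin; apply: le_lt_trans sr _.
  by rewrite ltr_pdivrMr// ltr_pMr// ltr1n.
- by move=> _; exists 1%R => // s /andP[s0 _]; split => //; rewrite ltry.
Qed.

Lemma near0_pos_tilts (R : realType) (smax : \bar R) : 0 < smax ->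
  \forall s \near 0%R^'+, pos_tilts smax s.
Proof.
move=> /pos_tilts_inhabited[e e0 He]; near=> s; apply: He; apply/andP; split.
  by near: s; exact: nbhs_right_gt.
by near: s; exact: nbhs_right_le.
Unshelve. all: by end_near. Qed.

(** Applied to the increasing slopes, this turns their limit at 0 into an infimum. It is taken in
    the extended reals since slopes can tend to -oo, as for 1 - sqrt s. *)
Lemma nondecreasing_pos_tilts_cvg (R : realType) (smax : \bar R)
    (g : R -> \bar R) : 0 < smax ->
  (forall x y, pos_tilts smax x -> pos_tilts smax y -> (x <= y)%R ->
     g x <= g y) ->
  g s @[s --> 0%R^'+] --> ereal_inf (g @` pos_tilts smax).
Proof.
move=> smax0 g_nd.
pose b : itv_bound R := if smax is r%:E then BLeft r else +oo%O.
have bE : [set` Interval (BRight 0%R) b] = pos_tilts smax.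
  rewrite /b; move: smax0; case: (smax) => [r| |] _ //;
  apply/seteqP; split => s /=; rewrite in_itv/= /pos_tilts/= ?andbT ?lte_fin.
  - by move=> /andP.
  - by move=> [-> ->].
  - by move=> s0; split => //; rewrite ltry.
  - by case.
rewrite -bE; apply: nondecreasing_at_right_cvge.
  by rewrite /b; move: smax0; case: (smax) => [r| |]//.
move=> x y xI yI; apply: g_nd; rewrite -bE; [exact: xI|exact: yI].
Qed.

Lemma near_upto_ge (R : realType) (smax : \bar R) (x : R) :
  pos_tilts smax x -> \forall s \near upto smax, pos_tilts smax s /\ (x <= s)%R.
Proof.
rewrite /upto; case: smax => [r| |] [x0] //=.
- rewrite lte_fin => xr; near=> s.
  have xs : (x <= s)%R by near: s; exact: nbhs_left_ge.
  split => //; split; first exact: lt_le_trans xs.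
  by rewrite lte_fin; near: s; exact: nbhs_left_lt.
- move=> _; near=> s.
  have xs : (x <= s)%R by near: s; apply: nbhs_pinfty_ge; exact: num_real.
  by split => //; split; [exact: lt_le_trans xs|rewrite ltry].
Unshelve. all: by end_near. Qed.

Lemma upto_proper_filter (R : realType) (smax : \bar R) :
  ProperFilter (upto smax).
Proof. by rewrite /upto; case: smax => [r| |]; exact: _. Qed.

(** The counterpart at the upper end, meant for the objective [s * Delta - Psi s], which increases
    when no tilt is critical and some slope is below [Delta]. *)
Lemma nondecreasing_upto_cvg (R : realType) (smax : \bar R)
    (g : R -> \bar R) : 0 < smax ->
  (forall x, pos_tilts smax x -> g x \is a fin_num) ->
  (forall x y, pos_tilts smax x -> pos_tilts smax y -> (x <= y)%R ->
     g x <= g y) ->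
  g s @[s --> upto smax] --> ereal_sup (g @` pos_tilts smax).
Proof.
move=> smax0 g_fin g_nd; have UF := upto_proper_filter smax.
have [e e0 He] := pos_tilts_inhabited smax0.
have Ie : pos_tilts smax e by apply: He; rewrite e0 /=.
have ub s : pos_tilts smax s -> g s <= ereal_sup (g @` pos_tilts smax).
  by move=> Is; apply: ereal_sup_ubound; exists s.
have above y : y < ereal_sup (g @` pos_tilts smax) ->
    \forall s \near upto smax, y < g s.
  move=> /ereal_sup_gt[_ [x Ix <-] yx].
  apply: filterS (near_upto_ge Ix) => s [Is xs].
  exact: lt_le_trans yx (g_nd _ _ Ix Is xs).
have := ub e Ie; have := g_fin e Ie.
move: ub above; case: (ereal_sup _) => [l| |] ub above.
- move=> _ _; apply/fine_cvgP; split.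
    by apply: filterS (near_upto_ge Ie) => s [Is _]; exact: g_fin.
  apply/cvgrPdist_le => eps eps0.
  have : (l - eps)%:E < l%:E by rewrite lte_fin ltrBlDr ltrDl.
  move=> /above; apply: filterS2 (near_upto_ge Ie) => s [Is _] lts.
  have := ub s Is; move: lts; rewrite -(fineK (g_fin s Is)) lte_fin lee_fin.
  by move=> h1 h2; rewrite /= ger0_norm; lra.
- move=> _ _; apply/cvgeyPge => A.
  by apply: filterS (above A%:E (ltry A)) => s /ltW.
- by case: (g e).
Qed.

(* A minimum of [f - Delta id] between two points where the slope lies on
   opposite sides of [Delta] would be a critical point. *)
Lemma derive1_lt_of_no_critical (R : realType) (smax : \bar R) (f : R -> R)
    (Delta s1 s2 : R) : strictly_convex_on (pos_tilts smax) f ->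
  (forall s, pos_tilts smax s -> derivable f s 1%R) ->
  ~ (exists2 s, pos_tilts smax s & derive1 f s = Delta) ->
  pos_tilts smax s1 -> pos_tilts smax s2 -> (derive1 f s1 < Delta)%R ->
  (derive1 f s2 < Delta)%R.
Proof.
move=> fcvx df nocrit I1 I2 d1.
rewrite ltNge; apply/negP => d2.
have {}d2 : (Delta < derive1 f s2)%R.
  by rewrite lt_neqAle d2 andbT; apply/eqP => d2E; apply: nocrit; exists s2.
have s12 : (s1 < s2)%R.
  rewrite ltNge; apply/negP; rewrite le_eqVlt => /predU1P[E|s21].
    by move: (lt_trans d1 d2); rewrite E ltxx.
  have := strictly_convex_derive1_lt fcvx df I2 I1 s21.
  by move=> /(lt_trans d2)/(lt_trans d1); rewrite ltxx.
pose h (s : R) := (f s - Delta * s)%R.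
have Iin s : (s1 <= s <= s2)%R -> pos_tilts smax s by exact: pos_tilts_itv.
have dh s : pos_tilts smax s -> is_derive s 1%R h (derive1 f s - Delta)%R.
  move=> Is; rewrite derive1E.
  have dfs : is_derive s 1%R f ('D_1 f s) by apply/derivableP; exact: df.
  by apply: is_derive_eq; rewrite /GRing.scale/= mulr1.
have hder s : pos_tilts smax s -> derivable h s 1%R.
  by move=> /dh [].
have hcont : {within `[s1, s2], continuous h}.
  apply: derivable_within_continuous => s; rewrite in_itv/= => Is.
  exact/hder/Iin.
have [m mI hm] := EVT_min (ltW s12) hcont.
have Im : pos_tilts smax m by apply: Iin; rewrite in_itv in mI.
move: (mI); rewrite in_itv/= => /andP[s1m ms2].
have dmE : derive1 h m = (derive1 f m - Delta)%R.
  by have [_] := dh m Im; rewrite -derive1E.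
have right_ge0 : (m < s2)%R -> (0 <= derive1 h m)%R.
  move=> ms2'; apply: (cvgr_to_ge (derive1_cvg_right (hder m Im))).
  near=> k.
  have k0 : (0 < k)%R by near: k; exact: nbhs_right_gt.
  have km : (k < s2 - m)%R by near: k; apply: nbhs_right_lt; rewrite subr_gt0.
  apply: mulr_ge0; first by rewrite invr_ge0 ltW.
  rewrite subr_ge0; apply: hm.
  by rewrite in_itv/=; apply/andP; split; lra.
have left_le0 : (s1 < m)%R -> (derive1 h m <= 0)%R.
  move=> s1m'; apply: (cvgr_to_le (derive1_cvg_left (hder m Im))).
  near=> k.
  have k0 : (k < 0)%R by near: k; exact: nbhs_left_lt.
  have km : (s1 - m < k)%R by near: k; apply: nbhs_left_gt; rewrite subr_lt0.
  apply: mulr_le0_ge0; first by rewrite invr_le0 ltW.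
  rewrite subr_ge0; apply: hm.
  by rewrite in_itv/=; apply/andP; split; lra.
(* The one-sided quotients exclude the endpoints: [m = s1] would give a slope of at least [Delta] at
   [s1], and [m = s2] a slope of at most [Delta] at [s2]. *)
have [m1|m1] := eqVneq s1 m.
  have ms2' : (m < s2)%R by rewrite -m1.
  by have := right_ge0 ms2'; rewrite dmE -m1; lra.
have s1m' : (s1 < m)%R by rewrite lt_neqAle m1.
have [m2|m2] := eqVneq m s2.
  by have := left_le0 s1m'; rewrite dmE m2; lra.
have ms2' : (m < s2)%R by rewrite lt_neqAle m2.
apply: nocrit; exists m => //.
have := left_le0 s1m'; have := right_ge0 ms2'; rewrite dmE.
by move=> h1 h2; apply/eqP; rewrite eq_le; apply/andP; split; lra.
Unshelve. all: by end_near. Qed.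

(** * The optimal tilt *)

Lemma tilts0_or_pos (R : realType) (smax : \bar R) (s : R) :
  tilts smax s -> s = 0%R \/ pos_tilts smax s.
Proof.
by move=> [s0 sm]; move: s0; rewrite le_eqVlt => /predU1P[<-|]; [left|right].
Qed.

Lemma pos_tiltsW (R : realType) (smax : \bar R) (s : R) :
  pos_tilts smax s -> tilts smax s.
Proof. by move=> [/ltW]. Qed.

Lemma slope0_cvg (R : realType) (smax : \bar R) (f : R -> R) : 0 < smax ->
  (forall s, pos_tilts smax s -> derivable f s 1%R) ->
  strictly_convex_on (pos_tilts smax) f ->
  (derive1 f s)%:E @[s --> 0%R^'+] -->
    ereal_inf [set (derive1 f s)%:E | s in pos_tilts smax].
Proof.
move=> smax0 df fcvx; apply: nondecreasing_pos_tilts_cvg => // x y Ix Iy.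
rewrite le_eqVlt => /predU1P[->//|xy].
by rewrite lee_fin ltW// (strictly_convex_derive1_lt fcvx df).
Qed.

Lemma tilt_cvg0 (R : realType) (Psi : R -> \bar R) (Delta : R) :
  Psi 0%R = 0 -> Psi s @[s --> 0%R^'+] --> Psi 0%R ->
  (s * Delta - fine (Psi s))%R @[s --> 0%R^'+] --> 0%R.
Proof.
move=> Psi0; rewrite Psi0 => /fine_cvg f0.
rewrite -[X in _ --> X](subr0 0%R) -[X in (X - _)%R](mul0r Delta).
apply: cvgB => //; apply: cvgM; last exact: cvg_cst.
by apply: cvg_at_right_filter; exact: cvg_id.
Qed.

(** The tangent at [sstar] has slope [Delta], so [sstar] beats every positive tilt; the tilt 0 is
    compared by letting positive tilts tend to 0. A jump at 0 would spoil this: for 1 + s^2 reset to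
    0 at s = 0 and [Delta = 1], the critical value is -3/4, below the value 0 at s = 0. *)
Lemma rate_critical (R : realType) (smax : \bar R) (Psi : R -> \bar R)
    (Delta sstar : R) : 0 < smax ->
  (forall s, pos_tilts smax s -> Psi s \is a fin_num) ->
  (forall s, pos_tilts smax s -> derivable (fine \o Psi) s 1%R) ->
  strictly_convex_on (pos_tilts smax) (fine \o Psi) ->
  Psi 0%R = 0 -> Psi s @[s --> 0%R^'+] --> Psi 0%R ->
  pos_tilts smax sstar -> derive1 (fine \o Psi) sstar = Delta ->
  rate smax Psi Delta = (sstar * Delta)%:E - Psi sstar.
Proof.
move=> smax0 Psi_fin df fcvx Psi0 Psi_cvg Istar dstar.
have le_star s : pos_tilts smax s ->
    (s * Delta - fine (Psi s) <= sstar * Delta - fine (Psi sstar))%R.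
  move=> Is.
  have := strictly_convex_tangent_weak fcvx Istar Is (df _ Istar).
  by rewrite dstar /=; nra.
rewrite -(fineK (Psi_fin _ Istar)) -EFinB.
apply/eqP; rewrite eq_le; apply/andP; split; last first.
  apply: ereal_sup_ubound; exists sstar; first exact: pos_tiltsW.
  by rewrite -(fineK (Psi_fin _ Istar)).
apply: ge_ereal_sup => _ [s /tilts0_or_pos[->|Is] <-]; last first.
  by rewrite -(fineK (Psi_fin _ Is)) -EFinB lee_fin le_star.
rewrite Psi0 mul0r sube0 lee_fin.
apply: (cvgr_to_le (tilt_cvg0 Delta Psi0 Psi_cvg)).
by apply: filterS (near0_pos_tilts smax0) => u; exact: le_star.
Qed.

(** One slope lies below [Delta] and none equals it, so all lie below and the objective increases;
    its supremum is the limit at the upper end, the tilt 0 being absorbed by continuity. *)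
Lemma rate_no_critical (R : realType) (smax : \bar R) (Psi : R -> \bar R)
    (Delta : R) : 0 < smax ->
  (forall s, pos_tilts smax s -> Psi s \is a fin_num) ->
  (forall s, pos_tilts smax s -> derivable (fine \o Psi) s 1%R) ->
  strictly_convex_on (pos_tilts smax) (fine \o Psi) ->
  Psi 0%R = 0 -> Psi s @[s --> 0%R^'+] --> Psi 0%R ->
  (exists2 s, pos_tilts smax s & (derive1 (fine \o Psi) s < Delta)%R) ->
  ~ (exists2 s, pos_tilts smax s & derive1 (fine \o Psi) s = Delta) ->
  (s * Delta)%:E - Psi s @[s --> upto smax] --> rate smax Psi Delta.
Proof.
move=> smax0 Psi_fin df fcvx Psi0 Psi_cvg [s1 I1 d1] nocrit.
pose g s : \bar R := (s * Delta)%:E - Psi s.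
have dlt s : pos_tilts smax s -> (derive1 (fine \o Psi) s < Delta)%R.
  by move=> Is; exact: derive1_lt_of_no_critical nocrit I1 Is d1.
have gE s : pos_tilts smax s -> g s = (s * Delta - fine (Psi s))%:E.
  by move=> Is; rewrite /g -[in LHS](fineK (Psi_fin _ Is)).
have -> : rate smax Psi Delta = ereal_sup (g @` pos_tilts smax).
  apply/eqP; rewrite eq_le; apply/andP; split; last first.
    by apply: ereal_sup_le => _ [s Is <-]; exists s => //; exact: pos_tiltsW.
  apply: ge_ereal_sup => _ [s /tilts0_or_pos[->|Is] <-]; last first.
    by apply: ereal_sup_ubound; exists s.
  rewrite Psi0 mul0r sube0.
  have ub u : pos_tilts smax u -> g u <= ereal_sup (g @` pos_tilts smax).
    by move=> Iu; apply: ereal_sup_ubound; exists u.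
  case: (ereal_sup _) ub => [M| |] ub; last 2 first.
  - by rewrite leey.
  - by have := ub _ I1; rewrite (gE _ I1).
  rewrite lee_fin; apply: (cvgr_to_le (tilt_cvg0 Delta Psi0 Psi_cvg)).
  apply: filterS (near0_pos_tilts smax0) => u Iu.
  by have := ub u Iu; rewrite (gE _ Iu) lee_fin.
apply: (@nondecreasing_upto_cvg _ _ g) => //.
  by move=> s Is; rewrite gE.
move=> x y Ix Iy xy; rewrite !gE// lee_fin.
have := strictly_convex_tangent_weak fcvx Iy Ix (df _ Iy).
have := dlt y Iy; rewrite /=; nra.
Qed.

(** If [s * Delta] exceeded [Psi s], the tangent at a point [q * s] near 0, of slope at least
    [Delta], together with [Psi (q * s) >= 0] would force [Psi s] to be at least
    [Delta * (s - q * s)], which is too large for small [q]. *)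
Lemma rate_eq0 (R : realType) (smax : \bar R) (Psi : R -> \bar R)
    (Delta : R) : 0 < smax -> (0 <= Delta)%R ->
  (forall s, tilts smax s -> 0 <= Psi s) ->
  (forall s, pos_tilts smax s -> Psi s \is a fin_num) ->
  (forall s, pos_tilts smax s -> derivable (fine \o Psi) s 1%R) ->
  strictly_convex_on (pos_tilts smax) (fine \o Psi) ->
  Psi 0%R = 0 ->
  (forall s, pos_tilts smax s -> (Delta <= derive1 (fine \o Psi) s)%R) ->
  rate smax Psi Delta = 0.
Proof.
move=> smax0 Delta0 Psi_ge0 Psi_fin df fcvx Psi0 dge.
have f0 s : pos_tilts smax s -> (0 <= fine (Psi s))%R.
  by move=> Is; apply: fine_ge0; apply/Psi_ge0/pos_tiltsW.
apply/eqP; rewrite eq_le; apply/andP; split; last first.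
  apply: ereal_sup_ubound; exists 0%R; first by split.
  by rewrite Psi0 mul0r sube0.
apply: ge_ereal_sup => _ [s /tilts0_or_pos[->|Is] <-].
  by rewrite Psi0 mul0r sube0.
rewrite -(fineK (Psi_fin _ Is)) -EFinB lee_fin subr_le0 leNgt; apply/negP => lt.
have [s0 _] := Is.
have D0 : (0 < s * Delta)%R by apply: le_lt_trans lt; exact: f0.
have D20 : (0 < 2 * (s * Delta))%R by rewrite pmulr_rgt0.
(* Chosen so that [q * s * Delta] is half of the supposed gap [s * Delta - Psi s]. *)
pose q := ((s * Delta - fine (Psi s)) / (2 * (s * Delta)))%R.
have qD : (q * (s * Delta) = (s * Delta - fine (Psi s)) / 2)%R.
  rewrite /q; field.
  by move: D0; rewrite lt0r mulf_eq0 negb_or => /andP[/andP[-> ->]].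
have q0 : (0 < q)%R.
  by apply: divr_gt0 => //; rewrite subr_gt0.
have q1 : (q < 1)%R.
  by rewrite /q ltr_pdivrMr// mul1r; have := f0 s Is; lra.
have Iqs : pos_tilts smax (q * s)%R.
  split; first by rewrite mulr_gt0.
  by case: Is => _; apply: lt_trans; rewrite lte_fin gtr_pMl.
have := strictly_convex_tangent_weak fcvx Iqs Is (df _ Iqs).
have := f0 _ Iqs; have := dge _ Iqs => /=.
move=> slope fqs0 tangent.
have : (Delta * (s - q * s) <= fine (Psi s) - fine (Psi (q * s)))%R.
  by apply: le_trans tangent; rewrite ler_wpM2r// subr_ge0 ler_piMl// ltW.
clear smax0 Psi0; lra.
Qed.

Unset Implicit Arguments.
Set Strict Implicit.

Theorem theorem3p2 (d : measure_display) (T : measurableType d) (R : realType)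
    (P0 P1 : probability T R) (F : nat -> set (set T))
    (HF : is_filtration F)
    (Hac : forall (t : nat) (A : set T), F t A -> P0 A = 0 -> P1 A = 0)
    (E : nat -> T -> \bar R) (HE : betting_sequence P0 F E)
    (smax : \bar R) (Hsmax : 0 < smax)
    (c : nat -> T -> R) (Hc : drift_certificate P1 F E c)
    (psi : nat -> R -> T -> \bar R) (Hpsi : majorant P1 F E c smax psi)
    (C : nat -> R) (Psi : nat -> R -> \bar R)
    (Hagg : aggregate P1 c smax psi C Psi) :
  (forall t : nat, (0 < t)%N ->
    (forall s : R, tilts smax s ->
       \int[P1]_w negpow (wealth E t w) s
         <= expeR (- (s * C t)%:E + Psi t s)) /\
    (forall alpha : R, (0 < alpha < 1)%R ->
       type2_seq P1 E alpha t <= type2_fixed P1 E alpha t /\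
       type2_fixed P1 E alpha t
         <= expeR (- rate smax (Psi t) (deviation C alpha t))) /\
    (forall alpha : R, (0 < alpha < 1)%R ->
       let Delta := deviation C alpha t in
       let dPsi := derive1 (fun s : R => fine (Psi t s)) in
       let slope0 := lim ((dPsi s)%:E @[s --> 0%R^'+]) in
       (forall s : R, pos_tilts smax s -> Psi t s \is a fin_num) ->
       (forall s : R, pos_tilts smax s ->
          derivable (fun s : R => fine (Psi t s)) s 1%R) ->
       strictly_convex_on (pos_tilts smax) (fun s : R => fine (Psi t s)) ->
       Psi t 0%R = 0 ->
       cvg ((dPsi s)%:E @[s --> 0%R^'+]) /\
       (slope0 < Delta%:E ->
          Psi t s @[s --> 0%R^'+] --> Psi t 0%R ->
          (forall sstar : R, pos_tilts smax sstar -> dPsi sstar = Delta ->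
             (forall s : R, pos_tilts smax s -> dPsi s = Delta ->
                s = sstar) /\
             rate smax (Psi t) Delta = (sstar * Delta)%:E - Psi t sstar) /\
          (~ (exists2 s : R, pos_tilts smax s & dPsi s = Delta) ->
             (s * Delta)%:E - Psi t s @[s --> upto smax]
               --> rate smax (Psi t) Delta)) /\
       (Delta%:E <= slope0 ->
          rate smax (Psi t) Delta = 0 /\
          rate smax (Psi t) Delta = (0 * Delta)%:E - Psi t 0%R /\
          expeR (- rate smax (Psi t) Delta) = 1))) /\
  (forall s delta : R, pos_tilts smax s -> (0 < delta < 1)%R ->
     (1 - delta)%:E <=
       P1 [set w | forall t : nat,
             (C t)%:E - (s^-1)%:E * (Psi t s + (ln (delta^-1))%:E)
               < lne (wealth E t w)]) /\
  (forall s delta alpha : R, pos_tilts smax s -> (0 < delta < 1)%R ->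
     (0 < alpha < 1)%R ->
     (1 - delta)%:E <=
       P1 [set w | rejection_time E alpha w
                     <= rejection_horizon C Psi alpha s delta]).
Proof.
split; [move=> t t0; split; [|split]|split].
- by move=> s Hs; exact: (negative_moment HF Hac HE Hc Hpsi Hagg t0 Hs).
- move=> alpha Halpha; split; first exact: (type2_seq_le_fixed P1 alpha HF HE t0).
  exact: (type2_fixed_le HF Hac HE Hc Hpsi Hagg t0 Halpha).
- move=> alpha Halpha Delta dPsi slope0 Psi_fin df fcvx Psi0.
  have slope_cvg := slope0_cvg Hsmax df fcvx.
  (* Both regimes are read off this infimum: below [Delta] it yields one tilt of slope less than
     [Delta], otherwise all slopes are at least [Delta]. *)
  have slope0E : slope0 =
      ereal_inf [set (dPsi s)%:E | s in pos_tilts smax].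
    exact: cvg_lim slope_cvg.
  split; first by apply/cvg_ex; eexists; exact: slope_cvg.
  split.
    move=> slope_lt Psi_cvg.
    have [s1 I1 d1] : exists2 s, pos_tilts smax s & (dPsi s < Delta)%R.
      move: slope_lt; rewrite slope0E => /ereal_inf_lt[_ [s Is <-]].
      by rewrite lte_fin => ?; exists s.
    split; last first.
      move=> nocrit; apply: rate_no_critical => //.
      by exists s1.
    move=> sstar Istar dstar; split; last first.
      exact: (rate_critical Hsmax Psi_fin df fcvx Psi0 Psi_cvg Istar dstar).
    move=> s Is ds; apply/eqP; rewrite eq_le !leNgt; apply/andP; split;
      apply/negP => lts.
      have := strictly_convex_derive1_lt fcvx df Istar Is lts.
      by rewrite -/dPsi ds dstar ltxx.
    have := strictly_convex_derive1_lt fcvx df Is Istar lts.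
    by rewrite -/dPsi ds dstar ltxx.
  move=> slope_ge.
  have Delta0 : (0 <= Delta)%R by rewrite /Delta /deviation le_max lexx orbT.
  have rate0 : rate smax (Psi t) Delta = 0.
    apply: (rate_eq0 Hsmax Delta0 _ Psi_fin df fcvx Psi0).
      by move=> s Hs; exact: (aggregate_ge0 Hagg t0 Hs).
    move=> s Is; rewrite -lee_fin; apply: le_trans slope_ge _.
    by rewrite slope0E; apply: ereal_inf_lbound; exists s.
  by rewrite rate0 Psi0 mul0r sube0 oppe0 expeR0.
- move=> s delta Hs Hdelta.
  by have [] := log_wealth_uniform HF Hac HE Hc Hpsi Hagg Hs Hdelta.
- move=> s delta alpha Hs Hdelta Halpha.
  exact: (rejection_time_le_horizon HF Hac HE Hc Hpsi Hagg Hs Hdelta Halpha).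
Qed.
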